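(* Let $k\ge 1$ be an integer. For every $f\in W^{k,2}_0(-1,1)$, $$\int_{-1}^1|f(x)|\,dx\;\le\;\frac{1}{(2k-1)!!\,\sqrt{k+\tfrac12}}\left(\int_{-1}^1|f^{(k)}(x)|^2\,dx\right)^{1/2}.$$ The inequality is sharp, i.e. the constant $\frac{1}{(2k-1)!!\sqrt{k+1/2}}$ cannot be replaced by any smaller constant. The extremal functions are given by the Landau kernel: for $f\in W^{k,2}_0(-1,1)$, equality holds if and only if $f=c\,L_k$ for some constant $c\in\mathbb{R}$.
   Context: For an integer $k\ge 1$, $W^{k,2}_0(-1,1)$ denotes the space of functions $f:\mathbb{R}\to\mathbb{R}$ with $\operatorname{supp} f\subseteq[-1,1]$ and $f^{(k)}\in L^2(\mathbb{R})$. Here the derivatives $f^{(j)}$, $0\le j<k$, are absolutely continuous on $\mathbb{R}$, and $f^{(k)}$ is the almost everywhere (equivalently, weak) derivative of $f^{(k-1)}$; in particular $f^{(j)}(\pm1)=0$ for all $0\le j<k$. The Landau kernel is $L_k(x)=(1-x^2)^k$ for $x\in[-1,1]$, extended by $0$ outside $[-1,1]$. The double factorial is $(2k-1)!!=1\cdot 3\cdot 5\cdots(2k-1)$. *)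

(* Defs.v *)
From HB Require Import structures.
From mathcomp Require Import all_boot all_order all_algebra.
From mathcomp Require Import all_classical all_reals all_analysis.

Set Implicit Arguments.
Unset Strict Implicit.
Unset Printing Implicit Defensive.

Import Order.TTheory GRing.Theory Num.Theory.
Import numFieldNormedType.Exports.

Local Open Scope classical_set_scope.
Local Open Scope ring_scope.

(* (2k-1)!! = 1 * 3 * ... * (2k-1) *)
Definition odd_dfact (k : nat) : nat := (\prod_(i < k) (2 * i + 1))%N.

Definition landau (R : realType) (k : nat) (x : R) : R :=
  if -1 <= x <= 1 then (1 - x ^+ 2) ^+ k else 0.

(* Absolute continuity on the whole line: one delta for all finite families
   of pairwise disjoint intervals. *)
Definition abs_continuous (R : realType) (F : R -> R) : Prop :=
  forall e : R, 0 < e -> exists2 d : R, 0 < d &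
    forall (n : nat) (a b : 'I_n -> R),
      (forall i, a i <= b i) ->
      trivIset setT (fun i => `]a i, b i[%classic) ->
      \sum_(i < n) (b i - a i) < d ->
      \sum_(i < n) `|F (b i) - F (a i)| < e.

(* The space W^{k,2}_0(-1,1), for 1 <= k.
   The library derivative [f^`(j)] is total, with a default value wherever the
   difference quotients do not converge. [W0_derivable] and [W0_ae_derivable]
   make sure that this value is never used for j < k, and only on a Lebesgue
   null set for j = k; thus [f^`(k)] represents the class of the almost
   everywhere derivative of f^(k-1). Membership in [Lfun] includes Borel
   measurability, which holds automatically because f^(k-1) is continuous and
   the default value of [f^`(k)] is a constant. *)
Record W0 (R : realType) (k : nat) (f : R -> R) : Prop := {
  W0_support : closure [set x | f x != 0] `<=` `[-1, 1] ;
  W0_derivable : forall j, (j.+1 < k)%N -> forall x, derivable f^`(j)%classic x 1 ;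
  W0_abs_continuous : forall j, (j < k)%N -> abs_continuous f^`(j)%classic ;
  W0_ae_derivable :
    {ae @lebesgue_measure R, forall x, derivable f^`(k.-1)%classic x 1} ;
  W0_L2 : f^`(k)%classic \in Lfun (@lebesgue_measure R) 2%:E
}.

Definition norm1 (R : realType) (f : R -> R) : R :=
  \int[@lebesgue_measure R]_(x in `[-1, 1]) `|f x|.

Definition norm2 (R : realType) (g : R -> R) : R :=
  Num.sqrt (\int[@lebesgue_measure R]_(x in `[-1, 1]) (`|g x| ^+ 2)).

Definition sharp_const (R : realType) (k : nat) : R :=
  ((odd_dfact k)%:R * Num.sqrt (k%:R + 2^-1))^-1.

(* Main.v *)
Require Import Defs.
From mathcomp Require Import all_boot all_order all_algebra.
From mathcomp Require Import all_classical all_reals all_analysis.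
From mathcomp Require Import ring lra zify measurable_realfun.

Import Order.TTheory GRing.Theory Num.Theory.
Import numFieldNormedType.Exports.

Local Open Scope classical_set_scope.
Local Open Scope ring_scope.

(* Let D be the derivative and theta = (1 - x) D. Put
     Phi_i = (theta + k + i - 1) ... (theta + k) f,
   so that Phi_k = (1 - x)^(2k) D^k (f / (1 - x)^k), whereas
   (1 - x)^k f^(k) = (theta + k - 1) ... (theta + 0) f.
   - Replacing the factor theta + (k - 1 - i) by theta + (k + i) changes the
     square of a function divided by (1 - x)^(2k) by an exact derivative whose
     boundary terms vanish; hence Phi_k / (1 - x)^k has the same L^2 norm as
     f^(k).
   - f is recovered from Phi_k by successive integrations with positive
     kernels, hence
       (k + 1) ... (2k) * int |f| <= int |Phi_k|.
   Cauchy-Schwarz against (1 - x)^k gives the inequality. Equality forces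
   |Phi_k| to be a multiple of (1 - x)^(2k); then |Phi_{k-1}| is the same multiple
   of (1 - x)^(2k-1) (1 + x), so Phi_{k-1} has a constant sign and coincides with
   the one of a multiple of the Landau kernel, for which
     Phi_i = k!/(k-i)! * (1 - x)^(k+i) (1 + x)^(k-i). *)

Set Implicit Arguments.
Unset Strict Implicit.

(** * Absolutely continuous functions *)

(* V bounds the variation of H inside the open set U. This form of absolute
   continuity is stable under products and holds for indefinite integrals
   without any manipulation of finite families of intervals. *)
Definition null_variation (R : realType) (a b : R) (H : R -> R) : Prop :=
  forall e : R, 0 < e -> exists2 d : R, 0 < d &
    forall U : set R, open U -> (@lebesgue_measure R U < d%:E)%E ->
    exists V : R -> R,
      [/\ (forall x y, a <= x -> x <= y -> y <= b -> V x <= V y),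
          V b - V a <= e &
          forall x y, a <= x -> x <= y -> y <= b -> `]x, y[ `<=` U ->
            `|H y - H x| <= V y - V x].

Lemma abs_continuous_null_variation (R : realType) (a b : R) (H : R -> R) :
  a <= b -> abs_continuous H -> null_variation a b H.
Proof.
move=> ab acH e e0.
have [d d0 Hd] := acH e e0.
exists d => // U oU mU.
pose S x := [set s : R | exists (n : nat) (l r : 'I_n -> R),
  [/\ (forall i, a <= l i /\ l i <= r i /\ r i <= x),
      trivIset setT (fun i => `]l i, r i[%classic),
      (forall i, `]l i, r i[ `<=` U) &
      s = \sum_(i < n) `|H (r i) - H (l i)|]].
have S0 x : S x 0.
  exists 0%N, (fun=> 0), (fun=> 0); split; try by case.
  by rewrite big_ord0.
have Sub x : ubound (S x) e.
  move=> s [n [l [r [lr tr subU ->]]]]; apply/ltW/Hd => //.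
    by move=> i; have [_ []] := lr i.
  rewrite -lte_fin; apply: le_lt_trans mU.
  have -> : (\sum_(i < n) (r i - l i))%:E =
      (@lebesgue_measure R) (\big[setU/set0]_(i < n) `]l i, r i[%classic).
    rewrite measure_bigsetU_ord//.
    rewrite -sumEFin; apply: eq_bigr => i _.
    have [_ [h1 _]] := lr i; move: h1; rewrite le_eqVlt => /predU1P[->|h1].
      by rewrite subrr set_itvoo0 measure0.
    have := @lebesgue_measure_itv R `]l i, r i[.
    by rewrite /= lte_fin h1 EFinB => <-.
  apply: le_measure.
  - by rewrite inE; apply: bigsetU_measurable.
  - by rewrite inE; exact: open_measurable.
  - by elim/big_ind : _ => // A B AU BU z [/AU|/BU].
have hs x : has_sup (S x) by split; [exists 0; exact: S0|exists e; exact: Sub].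
exists (fun x => sup (S x)); split.
- move=> x y ax xy yb; apply: ge_sup; first by exists 0; exact: S0.
  move=> s [n [l [r [lr tr subU ->]]]].
  apply: ub_le_sup; first by exists e; exact: Sub.
  exists n, l, r; split=> // i; have [? [? h]] := lr i; do !split => //.
  exact: le_trans h xy.
- rewrite lerBlDr; apply: (@le_trans _ _ e).
    by apply: ge_sup; [exists 0; exact: S0|exact: Sub].
  rewrite lerDl; apply: ub_le_sup; first by exists e; exact: Sub.
  exact: S0.
- move=> x y ax xy yb xyU; rewrite lerBrDl -lerBrDr.
  apply: ge_sup; first by exists 0; exact: S0.
  move=> s [n [l [r [lr tr subU ->]]]]; rewrite lerBrDr.
  apply: ub_le_sup; first by exists e; exact: Sub.
  exists n.+1, (fun i => oapp l x (unlift ord0 i)),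
               (fun i => oapp r y (unlift ord0 i)).
  split.
  + move=> i; case: unliftP => [j _|_] /=; last by [].
    have [? [? h]] := lr j; do !split => //; exact: le_trans h xy.
  + apply/trivIsetP => i j _ _.
    case: unliftP => [i' ->|->]; case: unliftP => [j' ->|->] //=.
    * rewrite (inj_eq lift_inj) => ij.
      by move/trivIsetP : tr => /(_ i' j' I I ij).
    * move=> _; apply/seteqP; split=> // z [] /=.
      rewrite !in_itv/= => /andP[_ z1] /andP[z2 _].
      have [_ [_ h]] := lr i'.
      by have := lt_trans (lt_le_trans z1 h) z2; rewrite ltxx.
    * move=> _; apply/seteqP; split=> // z [] /=.
      rewrite !in_itv/= => /andP[z2 _] /andP[_ z1].
      have [_ [_ h]] := lr j'.
      by have := lt_trans (lt_le_trans z1 h) z2; rewrite ltxx.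
  + by move=> i; case: unliftP => [j _|_] /=; [exact: subU|].
  + rewrite big_ord_recl unlift_none/= addrC; congr (_ + _).
    by apply: eq_bigr => i _; rewrite liftK.
Qed.

Lemma is_derive0_approx (R : realType) (H : R -> R) (x e : R) :
  is_derive x 1 H 0 -> 0 < e ->
  exists2 d, 0 < d & forall y, `|y - x| < d -> `|H y - H x| <= e * `|y - x|.
Proof.
move=> [dH DH] e0.
have : h^-1 *: (H (h *: 1 + x) - H x) @[h --> 0^'] --> (0 : R).
  have /cvg_ex[l hl] := dH.
  have l0 : l = 0 by rewrite -DH; apply/esym/cvg_lim => //; exact: Rhausdorff.
  by move: hl; rewrite l0.
move/cvgrPdist_le => /(_ e e0).
rewrite near_withinE => /nbhs_ballP[d /= d0 hd].
exists d => // y yxd.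
have [->|yx] := eqVneq y x; first by rewrite !subrr !normr0 mulr0.
have yx0 : y - x != 0 by rewrite subr_eq0.
have := hd (y - x).
rewrite /ball/= sub0r normrN => /(_ yxd yx0).
rewrite sub0r normrN [_ *: 1]mulr1 subrK normrZ normfV.
by rewrite mulrC ler_pdivrMr// normr_gt0.
Qed.

Lemma null_variation_cst (R : realType) (a b : R) (H : R -> R) :
  a <= b -> null_variation a b H ->
  {ae @lebesgue_measure R, forall x, a < x < b -> is_derive x 1 H 0} ->
  H b = H a.
Proof.
move=> ab nvH [A [mA A0 subA]].
have [->//|anb] := eqVneq a b.
have {anb}ltab : a < b by rewrite lt_neqAle anb.
apply/eqP; rewrite -subr_eq0 -normr_le0.
apply/ler_addgt0Pr => e e0; rewrite add0r.
pose c0 := e / 2; pose c1 := e / (2 * (b - a)).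
have ba0 : 0 < b - a by rewrite subr_gt0.
have c00 : 0 < c0 by rewrite divr_gt0.
have c10 : 0 < c1 by rewrite divr_gt0// mulr_gt0.
have [d d0 Hd] := nvH c0 c00.
pose D := A `|` ([set a] `|` [set b]).
have mD : measurable D by apply: measurableU => //; exact: measurableU.
have D0 : lebesgue_measure D = 0%E.
  rewrite /D measureU0//; last 1 first.
    by rewrite measureU0//; [exact: lebesgue_measure_set1|exact: lebesgue_measure_set1].
  exact: measurableU.
have Dfin : (lebesgue_measure D < +oo)%E by rewrite D0.
have [U [oU DU UD]] := lebesgue_regularity_outer mD Dfin d0.
have mU : (@lebesgue_measure R U < d%:E)%E.
  have <- : (U `\` D) `|` D = U by rewrite setUC setDUK.
  have -> : lebesgue_measure ((U `\` D) `|` D) = lebesgue_measure (U `\` D).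
    by apply: measureU0 => //; apply: measurableD => //; exact: open_measurable.
  exact: UD.
have [V [Vm Vab VH]] := Hd U oU mU.
(* Around every point of [a, b] the increments of H are controlled, by V on the
   null set and by the vanishing derivative elsewhere. *)
have loc c : a <= c -> c <= b -> exists2 r, 0 < r &
    forall x y, a <= x -> x <= c -> c <= y -> y <= b -> c - x < r -> y - c < r ->
    `|H y - H x| <= c1 * (y - x) + (V y - V x).
  move=> ac cb; have [cD|cD] := pselect (D c).
    have /nbhs_ballP[r /= r0 rU] : nbhs c U by apply: open_nbhs_nbhs; split => //; exact: DU.
    exists r => // x y ax xc cy yb cxr ycr.
    rewrite -[leLHS]add0r lerD//.
      by rewrite mulr_ge0// ?subr_ge0 ?(le_trans xc)// ltW.
    apply: VH => //; first exact: le_trans cy.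
    move=> z /=; rewrite in_itv/= => /andP[xz zy]; apply: rU.
    by rewrite /ball/= ltr_norml; apply/andP; split; lra.
  have dc : is_derive c 1 H 0.
    have : ~ (~` [set x | a < x < b -> is_derive x 1 H 0]) c.
      by move=> /subA cA; apply: cD; left.
    move=> /contrapT; apply.
    rewrite !lt_neqAle ac cb !andbT; apply/andP; split.
      by apply/eqP => ca; apply: cD; right; left.
    by apply/eqP => ca; apply: cD; right; right.
  have [r r0 Hr] := is_derive0_approx dc c10.
  exists r => // x y ax xc cy yb cxr ycr.
  have := Hr x; rewrite distrC ger0_norm ?subr_ge0// => /(_ cxr) hx.
  have := Hr y; rewrite ger0_norm ?subr_ge0// => /(_ ycr) hy.
  rewrite -[leLHS]addr0 lerD//; last first.
    by rewrite subr_ge0 Vm// (le_trans xc).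
  rewrite -(subrK (H c) (H y)) -addrA (le_trans (ler_normD _ _))//.
  rewrite distrC in hx.
  by rewrite (le_trans (lerD hy hx))// -mulrDr ler_pM2l//; lra.
pose Q x := `|H x - H a| <= c1 * (x - a) + (V x - V a).
pose S := [set x | a <= x <= b /\ Q x].
have Sa : S a by split; rewrite ?lexx ?ab// /Q !subrr normr0 mulr0 addr0.
have ubS : ubound S b by move=> x [/andP[]].
have hS : has_sup S by split; [exists a|exists b].
pose c := sup S.
have ac : a <= c by apply: ub_le_sup => //; exists b.
have cb : c <= b by apply: ge_sup => //; exists a.
have [r r0 Hr] := loc c ac cb.
have [x [/andP[ax xb] Qx] cx] := sup_adherent r0 hS.
have xc : x <= c by apply: ub_le_sup; [exists b|split; rewrite ?ax].
have step y : c <= y -> y <= b -> y - c < r -> Q y.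
  move=> cy yb ycr; rewrite /Q -(subrK (H x) (H y)) -addrA.
  rewrite (le_trans (ler_normD _ _))//.
  have := Hr x y ax xc cy yb _ ycr.
  rewrite -/c in cx.
  have -> : c - x < r by lra.
  move=> /(_ isT) h; have := Qx; rewrite /Q => h'.
  by rewrite (le_trans (lerD h h'))//; lra.
have cbE : c = b.
  apply/eqP; rewrite eq_le cb leNgt; apply/negP => ltcb.
  pose y := Num.min b (c + r / 2).
  have cy : c < y by rewrite /y lt_min ltcb ltrDl divr_gt0.
  have yb : y <= b by rewrite /y ge_min lexx.
  have : y <= c.
    apply: ub_le_sup; first by exists b.
    split; first by rewrite yb andbT (le_trans ac)// ltW.
    apply: step => //; first exact: ltW.
    have : y <= c + r / 2 by rewrite /y ge_min lexx orbT.
    by lra.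
  by rewrite leNgt cy.
have : Q b by apply: step; rewrite ?cbE// subrr.
rewrite /Q => /le_trans; apply.
have -> : c1 * (b - a) = e / 2 by rewrite /c1; field; rewrite gt_eqF.
by rewrite /c0 in Vab; lra.
Qed.

Lemma null_variationB (R : realType) (a b : R) (F G : R -> R) :
  null_variation a b F -> null_variation a b G ->
  null_variation a b (fun x => F x - G x).
Proof.
move=> nF nG e e0.
have e2 : 0 < e / 2 by rewrite divr_gt0.
have [d1 d10 H1] := nF _ e2; have [d2 d20 H2] := nG _ e2.
exists (Num.min d1 d2); first by rewrite lt_min d10.
move=> U oU; rewrite EFin_min lt_min => /andP[mU1 mU2].
have [V1 [m1 l1 h1]] := H1 U oU mU1; have [V2 [m2 l2 h2]] := H2 U oU mU2.
exists (fun x => V1 x + V2 x); split.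
- by move=> x y *; rewrite lerD ?m1 ?m2.
- by lra.
- move=> x y ax xy yb xyU.
  have -> : F y - G y - (F x - G x) = (F y - F x) - (G y - G x) by ring.
  rewrite (le_trans (ler_normB _ _))//.
  have := h1 x y ax xy yb xyU; have := h2 x y ax xy yb xyU; lra.
Qed.

Lemma null_variationM (R : realType) (a b M : R) (F G : R -> R) :
  (forall x, a <= x <= b -> `|F x| <= M) ->
  (forall x, a <= x <= b -> `|G x| <= M) ->
  null_variation a b F -> null_variation a b G ->
  null_variation a b (fun x => F x * G x).
Proof.
move=> bF bG nF nG e e0.
pose N := `|M| + 1.
have N0 : 0 < N by rewrite ltr_wpDl.
have MN : M <= N by rewrite (le_trans (ler_norm _))// lerDl.
have e2 : 0 < e / (2 * N) by rewrite divr_gt0// mulr_gt0.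
have [d1 d10 H1] := nF _ e2; have [d2 d20 H2] := nG _ e2.
exists (Num.min d1 d2); first by rewrite lt_min d10.
move=> U oU; rewrite EFin_min lt_min => /andP[mU1 mU2].
have [V1 [m1 l1 h1]] := H1 U oU mU1; have [V2 [m2 l2 h2]] := H2 U oU mU2.
exists (fun x => N * (V1 x + V2 x)); split.
- by move=> x y *; rewrite ler_pM2l// lerD ?m1 ?m2.
- have -> : e = N * (e / (2 * N) + e / (2 * N)) by field; rewrite gt_eqF.
  by rewrite -mulrBr ler_pM2l//; lra.
- move=> x y ax xy yb xyU.
  have -> : F y * G y - F x * G x = (F y - F x) * G y + F x * (G y - G x) by ring.
  rewrite (le_trans (ler_normD _ _))// !normrM -mulrBr.
  have := h1 x y ax xy yb xyU; have := h2 x y ax xy yb xyU => h2' h1'.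
  have Gy : `|G y| <= N by rewrite (le_trans (bG _ _))// yb andbT (le_trans ax).
  have Fx : `|F x| <= N by rewrite (le_trans (bF _ _))// ax (le_trans xy).
  have -> : N * (V1 y + V2 y - (V1 x + V2 x)) = (V1 y - V1 x) * N + N * (V2 y - V2 x) by ring.
  by apply: lerD; apply: ler_pM.
Qed.

Notation leb R := (@lebesgue_measure R).

(* Primitive in the sense of absolutely continuous functions. *)
Definition pac (R : realType) (a b : R) (H h : R -> R) : Prop :=
  (leb R).-integrable `[a, b] (EFin \o h) /\
  forall x, a <= x <= b -> \int[leb R]_(t in `[a, x]) h t = H x - H a.

Section pac.
Context (R : realType).
Implicit Types (a b : R) (F G H f g h : R -> R).
Local Notation mu := (leb R).

Lemma integrable_sub_itv a b x y h : a <= x -> y <= b ->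
  mu.-integrable `[a, b] (EFin \o h) -> mu.-integrable `[x, y] (EFin \o h).
Proof.
move=> ax yb; apply: integrableS => // z /=.
by rewrite !in_itv/= => /andP[xz zy]; rewrite (le_trans ax)//= (le_trans zy).
Qed.

Lemma Rintegral_itv_split a c b h : a <= c -> c <= b ->
  mu.-integrable `[a, b] (EFin \o h) ->
  \int[mu]_(t in `[a, b]) h t =
  \int[mu]_(t in `[a, c]) h t + \int[mu]_(t in `[c, b]) h t.
Proof.
move=> ac cb ih.
have := @Rintegral_itvB R h (BLeft a) (BRight b) c ih.
rewrite !bnd_simp => /(_ ac cb).
rewrite Rintegral_itv_obnd_cbnd => [/eqP|]; first by rewrite subr_eq addrC => /eqP.
apply: integrableS ih => // z /=.
by rewrite !in_itv/= => /andP[xz ->]; rewrite (le_trans ac)// ltW.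
Qed.

Lemma pac_sub a b x y H h : a <= x -> x <= y -> y <= b ->
  pac a b H h -> pac x y H h.
Proof.
move=> ax xy yb [ih Hh]; split; first exact: integrable_sub_itv ih.
move=> z /andP[xz zy].
have zb := le_trans zy yb.
have := Hh z; rewrite (le_trans ax xz) zb => /(_ isT).
rewrite (@Rintegral_itv_split a x z)//; last exact: integrable_sub_itv ih.
have -> := Hh x; last by rewrite ax (le_trans xy).
by lra.
Qed.

Lemma pacE a b H h : a <= b -> pac a b H h ->
  \int[mu]_(t in `[a, b]) h t = H b - H a.
Proof. by move=> ab [_ ->]//; rewrite ab lexx. Qed.

Lemma pac_continuous a b H h : a <= b -> pac a b H h ->
  {within `[a, b], continuous H}.
Proof.
move=> ab [ih Hh].
have := parameterized_integral_continuous ab ih.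
set I := (X in {within _, continuous X}) => cI.
have {}cI : {within `[a, b], continuous (fun x => I x + H a)}.
  by move=> x; apply: cvgD; [exact: cI|exact: cvg_cst].
apply: subspace_eq_continuous cI => x.
rewrite inE/= in_itv/= => xab.
have E := Hh x xab.
rewrite /from_subspace /I /parameterized_integral.
by rewrite -[RHS](subrK (H a)) -E.
Qed.

Lemma continuous_itv_bounded a b H : {within `[a, b], continuous H} ->
  exists M, forall x, a <= x <= b -> `|H x| <= M.
Proof.
move=> cH.
have /compact_bounded[M [_ HM]] := continuous_compact cH (@segment_compact R a b).
exists (M + 1) => x xab; apply: HM; first by rewrite ltrDl.
by exists x => //=; rewrite in_itv.
Qed.

Lemma continuous_itv_measurable a b H : {within `[a, b], continuous H} ->
  measurable_fun `[a, b] H.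
Proof. by move=> cH; exact: subspace_continuous_measurable_fun. Qed.

Lemma integrable_bounded_mul a b H h : {within `[a, b], continuous H} ->
  mu.-integrable `[a, b] (EFin \o h) ->
  mu.-integrable `[a, b] (EFin \o (fun x => H x * h x)).
Proof.
move=> cH ih.
have [M HM] := continuous_itv_bounded cH.
have mh : measurable_fun `[a, b] h.
  by apply/measurable_EFinP; case/integrableP : ih.
apply: (le_integrable _ _ _ (integrableZl _ `|M| ih)) => //.
  by apply/measurable_EFinP; apply: measurable_funM => //; exact: continuous_itv_measurable.
move=> x; rewrite /= in_itv/= => /HM HMx.
by rewrite lee_fin !normrM normr_id ler_wpM2r// (le_trans HMx)// ler_norm.
Qed.

Lemma le_Rintegral_subset (A B : set R) h : measurable A -> measurable B ->
  A `<=` B -> (forall x, B x -> 0 <= h x) -> mu.-integrable B (EFin \o h) ->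
  \int[mu]_(t in A) h t <= \int[mu]_(t in B) h t.
Proof.
move=> mA mB AB h0 ih; rewrite -(setDUK AB) Rintegral_setU//.
- by rewrite lerDl Rintegral_ge0// => x [/h0].
- exact: measurableD.
- by rewrite setDUK.
- by apply/disj_setPS => z [/= Az [_]].
Qed.

Lemma pac_null_variation a b H h : a <= b -> pac a b H h -> null_variation a b H.
Proof.
move=> ab [ih Hh] e e0.
have ig : mu.-integrable setT (EFin \o (h \_ `[a, b])).
  by rewrite -restrict_EFin; apply/integrable_restrict => //=; rewrite setTI.
have [d [d0 Hd]] := integral_normr_continuous ig e0.
exists d => // U oU mU.
have mUm := open_measurable oU.
pose g := Num.norm \o (h \_ `[a, b]).
have ign : mu.-integrable setT (EFin \o g) by exact: integrable_norm.
have igS (A : set R) : measurable A -> mu.-integrable A (EFin \o g).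
  by move=> mA; apply: integrableS ign.
pose V x := \int[mu]_(t in U `&` `]-oo, x]) g t.
have VB x y : x <= y -> V y = V x + \int[mu]_(t in U `&` `]x, y]) g t.
  move=> xy; rewrite /V -Rintegral_setU//=.
  - congr Rintegral; rewrite -setIUr; congr (_ `&` _).
    by rewrite -itv_bndbnd_setU// bnd_simp.
  - exact: measurableI.
  - exact: measurableI.
  - by apply: igS; apply: measurableU; exact: measurableI.
  - apply/disj_setPS => z [[_ +] [_]] /=; rewrite !in_itv/= => zx /andP[].
    by move: zx; rewrite in_itv/= ltNge => ->.
exists V; split.
- by move=> x y _ xy _; rewrite (VB x y xy) lerDl Rintegral_ge0// => z _; exact: normr_ge0.
- rewrite (VB a b ab) addrC addKr; apply: ltW; apply: Hd.
    exact: measurableI.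
  apply: le_lt_trans mU; apply: le_measure; rewrite ?inE//; first exact: measurableI.
- move=> x y ax xy yb xyU; rewrite (VB x y xy) [leRHS]addrAC subrr add0r.
  have -> : H y - H x = \int[mu]_(t in `[x, y]) h t.
    by rewrite (pacE xy (@pac_sub a b x y H h ax xy yb (conj ih Hh))).
  have ixy := integrable_sub_itv ax yb ih.
  apply: le_trans (le_normr_Rintegral _ ixy) _ => //.
  rewrite -Rintegral_itv_obnd_cbnd; last first.
    apply: (integrableS _ _ _ (integrable_norm ixy)) => // z /=.
    by rewrite !in_itv/= => /andP[/ltW-> ->].
  rewrite -Rintegral_itv_bndo_bndc; last first.
    apply: (integrableS _ _ _ (integrable_norm ixy)) => // z /=.
    by rewrite !in_itv/= => /andP[/ltW-> /ltW->].
  have -> : \int[mu]_(t in `]x, y[) `|h t| = \int[mu]_(t in `]x, y[) g t.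
    apply: eq_Rintegral; move=> z; rewrite inE/= in_itv/= => /andP[xz zy].
    rewrite /g/= patchE mem_set//= in_itv/=.
    by rewrite (le_trans ax (ltW xz)) (le_trans (ltW zy)).
  apply: le_Rintegral_subset => //; last 2 first.
  + by move=> z _; exact: normr_ge0.
  + by apply: igS; exact: measurableI.
  + exact: measurableI.
  + move=> z xyz; split; first exact: xyU.
    by move: xyz; rewrite /= !in_itv/= => /andP[-> /ltW->].
Qed.

Lemma null_variation_sub a b x y H : a <= x -> x <= y -> y <= b ->
  null_variation a b H -> null_variation x y H.
Proof.
move=> ax xy yb nH e e0; have [d d0 Hd] := nH e e0; exists d => // U oU mU.
have [V [V1 V2 V3]] := Hd U oU mU.
have Vx := V1 a x (lexx a) ax (le_trans xy yb).
have Vy := V1 y b (le_trans ax xy) yb (lexx b).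
exists V; split.
- by move=> u v xu uv vy; rewrite V1// ?(le_trans ax)// (le_trans vy).
- by lra.
- by move=> u v xu uv vy; apply: V3 => //; rewrite ?(le_trans ax)// (le_trans vy).
Qed.

Lemma pac_ae_derive a b H h : pac a b H h ->
  {ae mu, forall x, a < x < b -> is_derive x 1 H (h x)}.
Proof.
move=> [ih Hh].
have ig : mu.-integrable setT (EFin \o (h \_ `[a, b])).
  by rewrite -restrict_EFin; apply/integrable_restrict => //=; rewrite setTI.
have lg : locally_integrable [set: R] (h \_ `[a, b]).
  by apply: open_integrable_locally => //; exact: openT.
have := @FTC1 R (h \_ `[a, b]) (BLeft a) _ lg.
pose F x := \int[mu]_(t in `[a, x]) (h \_ `[a, b]) t.
have iy y : mu.-integrable [set` Interval (BLeft a) (BRight y)] (EFin \o h \_ `[a, b]).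
  exact: integrableS ig.
move=> /(_ iy).
apply: (@filterS _ _ (ae_filter_ringOfSetsType mu)) => x FD /andP[ax xb].
have [dF F'] : derivable F x 1 /\ derive1 F x = (h \_ `[a, b]) x.
  by apply: FD; rewrite lte_fin.
have {F'}F' : derive1 F x = h x.
  by rewrite F' patchE mem_set//= in_itv/= !ltW.
have DF : is_derive x 1 (F + cst (H a)) (h x).
  apply: is_derive_eq (addr0 _).
  apply: is_deriveD; rewrite -F' derive1E; exact: derivableP.
apply: near_eq_is_derive DF.
have : \forall y \near x, y \in `]a, b[ by apply: near_in_itvoo; rewrite in_itv/= ax.
apply: filterS => y; rewrite in_itv/= => /andP[ay yb].
have := Hh y; rewrite (ltW ay) (ltW yb) => /(_ isT) E.
rewrite /= -[RHS](subrK (H a)) -E; congr (_ + _).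
apply: eq_Rintegral => z; rewrite inE/= in_itv/= => /andP[az zy].
by rewrite patchE mem_set//= in_itv/= az (le_trans zy (ltW yb)).
Qed.

Lemma pac_intro a b H h : null_variation a b H ->
  mu.-integrable `[a, b] (EFin \o h) ->
  {ae mu, forall x, a < x < b -> is_derive x 1 H (h x)} ->
  pac a b H h.
Proof.
move=> nH ih dH; split => // x /andP[ax xb].
pose F y := \int[mu]_(t in `[a, y]) h t.
have Fa : F a = 0 by rewrite /F set_itv1 Rintegral_set1.
have pF : pac a b F h by split => // y _; rewrite Fa subr0.
have ab := le_trans ax xb.
suff : H x - F x = H a - F a by rewrite Fa -/(F x); lra.
apply: (@null_variation_cst _ a x (fun y => H y - F y)) => //.
  apply: null_variationB; first exact: null_variation_sub nH.
  by apply: null_variation_sub (pac_null_variation _ pF).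
have := pac_ae_derive pF.
apply: (@filterS2 _ _ (ae_filter_ringOfSetsType mu)) dH => y Hy Fy /andP[ay yx].
have ayb : a < y < b by rewrite ay (lt_le_trans yx).
have := is_deriveB (Hy ayb) (Fy ayb).
by rewrite subrr.
Qed.

Lemma pac_C1 a b H h : {within `[a, b], continuous h} ->
  (forall x, a <= x <= b -> is_derive x 1 H (h x)) -> pac a b H h.
Proof.
move=> ch dH; split.
  by apply: continuous_compact_integrable => //; exact: segment_compact.
move=> x /andP[]; rewrite le_eqVlt => /predU1P[<- _|ax xb].
  by rewrite set_itv1 Rintegral_set1 subrr.
have dx y : a <= y <= x -> derivable H y 1.
  by move=> /andP[ay yx]; case: (dH y) => //; rewrite ay (le_trans yx).
have cH y : a <= y <= x -> {for y, continuous H}.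
  by move=> /dx /derivable1_diffP/differentiable_continuous.
rewrite /Rintegral (@continuous_FTC2 _ h H a x)//.
- apply: continuous_subspaceW ch => z /=.
  by rewrite !in_itv/= => /andP[-> /le_trans->].
- split.
  + by move=> y; rewrite in_itv/= => /andP[ay yx]; apply: dx; rewrite !ltW.
  + by apply: cvg_at_right_filter; apply: cH; rewrite lexx ltW.
  + by apply: cvg_at_left_filter; apply: cH; rewrite lexx ltW.
- move=> y; rewrite in_itv/= => /andP[ay yx].
  by rewrite derive1E; case: (dH y) => //; rewrite ltW//= ltW// (lt_le_trans yx).
Qed.

End pac.

Section pac_algebra.
Context (R : realType) (a b : R).
Implicit Types (F G H f g h : R -> R).
Local Notation mu := (leb R).
Local Notation intb h := (mu.-integrable `[a, b] (EFin \o h)).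

Lemma eq_integrable_itv f g : (forall x, a <= x <= b -> f x = g x) ->
  intb f -> intb g.
Proof.
move=> fg; apply: eq_integrable => // x.
by rewrite inE/= in_itv/= => /fg ->.
Qed.

Lemma integrable_itvD f g : intb f -> intb g -> intb (fun x => f x + g x).
Proof. by move=> jf jg; have := integrableD _ jf jg; exact. Qed.

Lemma integrable_itvB f g : intb f -> intb g -> intb (fun x => f x - g x).
Proof. by move=> jf jg; have := integrableB _ jf jg; exact. Qed.

Lemma integrable_itvZ c f : intb f -> intb (fun x => c * f x).
Proof. by move=> jf; have := integrableZl _ c jf; exact. Qed.

Lemma integrable_itv_norm f : intb f -> intb (fun x => `|f x|).
Proof. by move=> jf; have := integrable_norm jf; exact. Qed.

Lemma integrable_itv_cont f : {within `[a, b], continuous f} -> intb f.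
Proof. by move=> cf; apply: continuous_compact_integrable => //; exact: segment_compact. Qed.

Lemma integrable_itv_le f g : measurable_fun `[a, b] f -> intb g ->
  (forall x, a <= x <= b -> `|f x| <= g x) -> intb f.
Proof.
move=> mf jg fg; apply: (le_integrable _ _ _ jg) => //; first exact/measurable_EFinP.
move=> x; rewrite /= in_itv/= => /fg fgx.
by rewrite lee_fin (le_trans fgx)// ler_norm.
Qed.

Lemma integrable_itv_measurable f : intb f -> measurable_fun `[a, b] f.
Proof. by move=> /integrableP[/measurable_EFinP]. Qed.

Lemma eq_Rintegral_itv f g : (forall x, a <= x <= b -> f x = g x) ->
  \int[mu]_(x in `[a, b]) f x = \int[mu]_(x in `[a, b]) g x.
Proof.
by move=> fg; apply: eq_Rintegral => x; rewrite inE/= in_itv/= => /fg.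
Qed.

Lemma le_Rintegral_itv f g : intb f -> intb g ->
  (forall x, a <= x <= b -> f x <= g x) ->
  \int[mu]_(x in `[a, b]) f x <= \int[mu]_(x in `[a, b]) g x.
Proof.
by move=> jf jg fg; apply: le_Rintegral => // x; rewrite /= in_itv/= => /fg.
Qed.

Lemma eq_pac F G f g : (forall x, a <= x <= b -> F x = G x) ->
  (forall x, a <= x <= b -> f x = g x) -> pac a b F f -> pac a b G g.
Proof.
move=> FG fg [jf Ff]; split; first exact: eq_integrable_itv jf.
move=> x /andP[ax xb].
have aab : a <= a <= b by rewrite lexx (le_trans ax).
rewrite -!FG ?ax// -Ff ?ax//.
apply: eq_Rintegral => z; rewrite inE/= in_itv/= => /andP[az zx].
by rewrite fg// az (le_trans zx).
Qed.

Lemma pac_prim h : intb h -> pac a b (fun x => \int[mu]_(t in `[a, x]) h t) h.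
Proof.
by move=> jh; split=> // x _; rewrite set_itv1 Rintegral_set1 subr0.
Qed.

Lemma pacD F G f g : pac a b F f -> pac a b G g ->
  pac a b (fun x => F x + G x) (fun x => f x + g x).
Proof.
move=> [jf Ff] [jg Gg]; split; first exact: integrable_itvD.
move=> x axb; have /andP[ax xb] := axb.
rewrite RintegralD// ?Ff ?Gg//; first by ring.
  exact: integrable_sub_itv jf.
exact: integrable_sub_itv jg.
Qed.

Lemma pacZ c F f : pac a b F f ->
  pac a b (fun x => c * F x) (fun x => c * f x).
Proof.
move=> [jf Ff]; split; first exact: integrable_itvZ.
move=> x axb; have /andP[ax xb] := axb.
rewrite RintegralZl// ?Ff//; first by ring.
exact: integrable_sub_itv jf.
Qed.

Lemma pacB F G f g : pac a b F f -> pac a b G g ->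
  pac a b (fun x => F x - G x) (fun x => f x - g x).
Proof.
move=> pF pG; have := pacD pF (pacZ (-1) pG).
by apply: eq_pac => x _; rewrite mulN1r.
Qed.

Lemma pac_sum n (F f : 'I_n -> R -> R) : (forall i, pac a b (F i) (f i)) ->
  pac a b (fun x => \sum_(i < n) F i x) (fun x => \sum_(i < n) f i x).
Proof.
elim: n F f => [|n IH] F f pF.
  have : pac a b (fun=> 0) (fun=> 0).
    split; last by move=> x _; rewrite subrr /Rintegral integral0.
    by have := @integrable0 _ _ _ mu `[a, b]%classic; exact.
  by apply: eq_pac => x _; rewrite big_ord0.
have := pacD (pF ord0) (IH (fun i => F (lift ord0 i)) (fun i => f (lift ord0 i)) _).
move=> /(_ (fun i => pF _)).
by apply: eq_pac => x _; rewrite big_ord_recl.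
Qed.

Hypothesis ab : a <= b.

Lemma pacM F G f g : pac a b F f -> pac a b G g ->
  pac a b (fun x => F x * G x) (fun x => F x * g x + G x * f x).
Proof.
move=> pF pG.
have cF := pac_continuous ab pF; have cG := pac_continuous ab pG.
have [M1 HM1] := continuous_itv_bounded cF.
have [M2 HM2] := continuous_itv_bounded cG.
apply: pac_intro.
- apply: (@null_variationM _ _ _ (Num.max M1 M2));
    [| |exact: (pac_null_variation ab pF)|exact: (pac_null_variation ab pG)].
  + by move=> x /HM1 h; rewrite le_max h.
  + by move=> x /HM2 h; rewrite le_max h orbT.
- apply: (@integrable_itvD (fun x => F x * g x) (fun x => G x * f x)).
    by apply: integrable_bounded_mul => //; case: pG.
  by apply: integrable_bounded_mul => //; case: pF.
- have := pac_ae_derive pG.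
  apply: (@filterS2 _ _ (ae_filter_ringOfSetsType mu)) (pac_ae_derive pF) => x DF DG xab.
  exact: (is_deriveM (DF xab) (DG xab)).
Qed.

Lemma pac_left_approx H h e : a < b -> pac a b H h -> 0 < e ->
  exists2 d, a <= d < b & forall x, d <= x <= b -> `|H b - H x| <= e.
Proof.
move=> ltab pH e0.
have /(continuous_within_itvP _ ltab)[_ _] := pac_continuous ab pH.
move=> /cvgrPdist_le/(_ e e0).
rewrite near_withinE => /nbhs_ballP[r /= r0 hr].
exists (Num.max a (b - r / 2)).
  by rewrite le_max lexx/= gt_max ltab/= ltrBlDr ltrDl divr_gt0.
move=> x /andP[]; rewrite ge_max => /andP[ax brx].
rewrite le_eqVlt => /predU1P[->|xb]; first by rewrite subrr normr0 ltW.
apply: hr => //; rewrite /ball/= gtr0_norm ?subr_gt0//.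
by lra.
Qed.

Lemma pac_le_end H h c : a < b -> pac a b H h ->
  (forall x, a <= x < b -> H x <= c) -> H b <= c.
Proof.
move=> ltab pH Hc; apply/ler_addgt0Pr => e e0.
have [d /andP[ad db] Hd] := pac_left_approx ltab pH e0.
have := Hd d; rewrite lexx (ltW db) => /(_ isT).
have := Hc d; rewrite ad db => /(_ isT).
by rewrite ler_norml => h1 /andP[h2 h3]; lra.
Qed.

End pac_algebra.

(** * The Euler operator (1 - x) d/dx *)

Section euler.
Context (R : realType).
Implicit Types (a b x y : R) (F G P h : R -> R) (c : nat -> R).
Local Notation mu := (leb R).

Lemma pac_horner a b (p : {poly R}) : pac a b (horner p) (horner p^`()).
Proof.
apply: pac_C1.
apply: derivable_within_continuous => x _.
by case: (is_derive_poly p^`() x).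
Qed.

Lemma pac_onem a b n :
  pac a b (fun x => (1 - x) ^+ n) (fun x => - (n%:R * (1 - x) ^+ n.-1)).
Proof.
have := pac_horner a b ((1 - 'X) ^+ n).
apply: eq_pac => x _; first by rewrite !hornerE.
by rewrite deriv_exp derivB derivX derivC !hornerE hornerMn !hornerE -mulr_natl; ring.
Qed.

Lemma pac_onemV a b n : b < 1 ->
  pac a b (fun x => (1 - x)^-1 ^+ n) (fun x => n%:R * (1 - x)^-1 ^+ n.+1).
Proof.
move=> b1.
have dV x : a <= x <= b -> is_derive x 1 (fun x : R => (1 - x)^-1) ((1 - x)^-1 ^+ 2).
  move=> /andP[_ xb].
  have x0 : 1 - x != 0 by rewrite subr_eq0 gt_eqF// (le_lt_trans xb).
  have [d1 D1] : is_derive x 1 (fun x : R => 1 - x) (-1).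
    have := is_derive_poly (1 - 'X : {poly R}) x.
    rewrite derivB derivX derivC !hornerE.
    by congr is_derive; apply/funext => z; rewrite !hornerE.
  apply: DeriveDef; first exact: derivableV.
  by rewrite deriveV// D1 [LHS]mulrN1 opprK exprVn.
have cV : {within `[a, b], continuous (fun x : R => (1 - x)^-1)}.
  by apply: derivable_within_continuous => x; rewrite in_itv/= => /dV[].
have p1 : pac a b (fun x => (1 - x)^-1) (fun x => (1 - x)^-1 * (1 - x)^-1).
  apply: pac_C1 => x.
  by apply: cvgM; exact: cV.
elim: n => [|n IH].
  have := pac_onem a b 0; apply: eq_pac => x _ //.
  by rewrite !mul0r oppr0.
have [ab|ba] := leP a b.
  have := pacM ab p1 IH; apply: eq_pac => x _; first by rewrite -exprS.
  by rewrite -(natr1 n) !exprS; ring.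
split; first by rewrite set_itv_ge ?bnd_simp -?ltNge//; exact: integrable_set0.
by move=> x /andP[ax xb]; have := le_trans ax xb; rewrite leNgt ba.
Qed.
(* G = (1 - x) F' almost everywhere on [-1, b]. *)
Definition eul b F G := pac (- 1) b F (fun x => (1 - x)^-1 * G x).

Section fixed_b.
Variable b : R.
Hypotheses (mb : -1 <= b) (b1 : b < 1).
Local Notation v := (fun x : R => (1 - x)^-1).

Lemma onem_gt0 x : x <= b -> 0 < 1 - x.
Proof. by move=> xb; rewrite subr_gt0 (le_lt_trans xb). Qed.

Lemma onemVK x n : x <= b -> (1 - x) ^+ n * (1 - x)^-1 ^+ n = 1.
Proof. by move=> xb; rewrite -exprMn mulfV ?expr1n// gt_eqF// onem_gt0. Qed.

Lemma continuous_onemV n : {within `[-1, b], continuous (fun x : R => (1 - x)^-1 ^+ n)}.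
Proof. exact: pac_continuous (pac_onemV _ _ b1). Qed.

Lemma eul_integrable F G : eul b F G -> mu.-integrable `[-1, b] (EFin \o G).
Proof.
move=> [iG _].
have := integrable_bounded_mul (pac_continuous mb (pac_onem (-1) b 1)) iG.
apply: eq_integrable_itv => x /andP[_ xb].
by rewrite mulrA -[1 - x in X in X * _]expr1 -[_^-1]expr1 onemVK// mul1r.
Qed.

Lemma eul_continuous F G : eul b F G -> {within `[-1, b], continuous F}.
Proof. exact: pac_continuous. Qed.

Lemma eul_weight (a : nat) F G : eul b F G ->
  pac (-1) b (fun x => (1 - x)^-1 ^+ a * F x)
    (fun x => (1 - x)^-1 ^+ a.+1 * (G x + a%:R * F x)).
Proof.
move=> eF; have := pacM mb (pac_onemV (-1) a b1) eF.
by apply: eq_pac => x _ //; rewrite exprS; ring.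
Qed.

Lemma eul_step_integrable (a : nat) F G P : eul b F G ->
  (forall x, P x = G x + a%:R * F x) ->
  mu.-integrable `[-1, b] (EFin \o P).
Proof.
move=> eF PE.
have := integrable_itvD (eul_integrable eF)
  (integrable_itvZ a%:R (integrable_itv_cont (eul_continuous eF))).
by apply: eq_integrable_itv => x _; rewrite PE.
Qed.

Lemma eul_step_le (a : nat) F G P : eul b F G -> F (-1) = 0 ->
  (forall x, P x = G x + a%:R * F x) ->
  forall x, -1 <= x <= b ->
  `|F x| <= (1 - x) ^+ a * \int[mu]_(t in `[-1, x]) ((1 - t)^-1 ^+ a.+1 * `|P t|).
Proof.
move=> eF F0 PE x /andP[x1 xb].
have := pac_sub (lexx _) x1 xb (eul_weight a eF).
move=> pw; have := pacE x1 pw; rewrite F0 mulr0 subr0 => wE.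
have -> : F x = (1 - x) ^+ a * ((1 - x)^-1 ^+ a * F x).
  by rewrite mulrA onemVK// mul1r.
rewrite normrM ger0_norm; last by rewrite exprn_ge0// ltW// onem_gt0.
rewrite ler_wpM2l//; first by rewrite exprn_ge0// ltW// onem_gt0.
rewrite -wE; have [iw _] := pw.
apply: le_trans (le_normr_Rintegral _ iw) _ => //.
rewrite le_eqVlt; apply/orP; left; apply/eqP.
apply: eq_Rintegral_itv => t /andP[_ tx].
rewrite -PE normrM ger0_norm// exprn_ge0// invr_ge0 ltW// onem_gt0//.
exact: le_trans xb.
Qed.

(* W(x) = int_{-1}^x (1 - t)^(-a-1) |P(t)| dt satisfies |F| <= (1 - x)^a W and
   ((1 - x)^(a+1) W)' = |P| - (a+1) (1 - x)^a W; integrate the latter. *)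
Lemma eul_step (a : nat) F G P : eul b F G -> F (-1) = 0 ->
  (forall x, P x = G x + a%:R * F x) ->
  a.+1%:R * \int[mu]_(x in `[-1, b]) `|F x| <= \int[mu]_(x in `[-1, b]) `|P x|.
Proof.
move=> eF F0 PE.
have iP := eul_step_integrable eF PE.
have iPn := integrable_itv_norm iP.
have ivP := integrable_bounded_mul (@continuous_onemV a.+1) iPn.
pose W x := \int[mu]_(t in `[-1, x]) ((1 - t)^-1 ^+ a.+1 * `|P t|).
have pW : pac (-1) b W (fun t => (1 - t)^-1 ^+ a.+1 * `|P t|) by exact: pac_prim.
have pyW := pacM mb (pac_onem (-1) b a.+1) pW.
have W0 : W (-1) = 0 by rewrite /W set_itv1 Rintegral_set1.
have pE : pac (-1) b (fun x => (1 - x) ^+ a.+1 * W x)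
    (fun x => `|P x| - a.+1%:R * ((1 - x) ^+ a * W x)).
  apply: eq_pac pyW => // x /andP[_ xb].
  by rewrite [X in X + _]mulrA onemVK//=; ring.
have iyW : mu.-integrable `[-1, b] (EFin \o (fun x => (1 - x) ^+ a * W x)).
  apply: integrable_bounded_mul; first exact: pac_continuous (pac_onem _ _ _).
  by apply: integrable_itv_cont; exact: pac_continuous pW.
have := pacE mb pE; rewrite W0 mulr0 subr0.
rewrite RintegralB//; last exact: integrable_itvZ.
rewrite RintegralZl// => E.
have Wb : 0 <= (1 - b) ^+ a.+1 * W b.
  rewrite mulr_ge0//; first by rewrite exprn_ge0// ltW// onem_gt0.
  apply: Rintegral_ge0 => t; rewrite /= in_itv/= => /andP[_ tb].
  by rewrite mulr_ge0// exprn_ge0// invr_ge0 ltW// onem_gt0.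
apply: (@le_trans _ _ (a.+1%:R * \int[mu]_(x in `[-1, b]) ((1 - x) ^+ a * W x))).
  rewrite ler_wpM2l//; apply: le_Rintegral_itv => //.
    by apply: integrable_itv_norm; apply: integrable_itv_cont; exact: eul_continuous eF.
  by move=> x xb; exact: (eul_step_le eF F0 PE).
by rewrite -subr_ge0 E.
Qed.

Lemma eul_quad n F G : eul b F G ->
  pac (-1) b (fun x => (1 - x)^-1 ^+ n * F x ^+ 2)
    (fun x => (1 - x)^-1 ^+ n.+1 * (n%:R * F x ^+ 2 + 2 * (F x * G x))).
Proof.
move=> eF; have := pacM mb (pac_onemV (-1) n b1) (pacM mb eF eF).
by apply: eq_pac => x _; rewrite ?exprS ?expr2//; ring.
Qed.

End fixed_b.
End euler.

Section symbols.
Context (R : realType) (k : nat).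
Implicit Types (a x : R) (c : nat -> R) (h : nat -> R -> R).
Local Notation mu := (leb R).

(* The sequence c encodes the operator sum_j c_j (1 - x)^j D^j, evaluated by
   [symT] on a family h with h_j in the role of D^j h_0; [symA a] is the
   composition with theta + a. *)
Definition symT h c x : R := \sum_(j < k.+1) c j * ((1 - x) ^+ j * h j x).

Definition symA a c : nat -> R :=
  fun j => (if j is j'.+1 then c j' else 0) + (a - j%:R) * c j.

Fixpoint symB (i : nat) c : nat -> R :=
  if i is i'.+1 then symA (k + i')%:R (symB i' c) else c.

Definition delta (m j : nat) : R := (j == m)%:R.

Lemma symT_A h a c x : symT h (symA a c) x = symT h (symA 0 c) x + a%R * symT h c x.
Proof.
rewrite /symT mulr_sumr -big_split/=; apply: eq_bigr => j _.
by rewrite /symA; case: (nat_of_ord j) => [|m]; ring.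
Qed.

Lemma symA_comm a a' c : symA a (symA a' c) = symA a' (symA a c).
Proof. by apply/funext => -[|[|j]]; rewrite /symA; ring. Qed.

Lemma symB_A i a c : symB i (symA a c) = symA a (symB i c).
Proof. by elim: i => //= i ->; rewrite symA_comm. Qed.

Lemma symA_delta m : symA m%:R (delta m) = delta m.+1.
Proof.
apply/funext => -[|j]; rewrite /symA /delta.
  by case: m => [|m]; rewrite ?eqxx ?subrr /= ?mul0r ?mulr0 addr0.
rewrite eqSS; have [->|_] := eqVneq j.+1 m; last by rewrite mulr0 addr0.
by rewrite subrr mul0r addr0.
Qed.

Lemma symB_supp i m c : (forall j, (m <= j)%N -> c j = 0) ->
  forall j, (m + i <= j)%N -> symB i c j = 0.
Proof.
move=> c0; elim: i => [|i IH] j; first by rewrite addn0; exact: c0.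
rewrite addnS => mij /=; rewrite /symA; case: j mij => // j mij.
by rewrite !IH ?mulr0 ?addr0// ltnW.
Qed.

Lemma delta_supp m j : (m < j)%N -> delta m j = 0.
Proof. by move=> mj; rewrite /delta gtn_eqF. Qed.

Lemma symB_delta_supp i m j : (m + i < j)%N -> symB i (delta m) j = 0.
Proof. by rewrite -addSn; apply: symB_supp => n; exact: delta_supp. Qed.

Record jet h : Prop := {
  jet_pac : forall j, (j < k)%N -> pac (-1) 1 (h j) (h j.+1) ;
  jet_left : forall j, (j < k)%N -> h j (-1) = 0 ;
  jet_right : forall j, (j < k)%N -> h j 1 = 0 ;
  jet_L2 : mu.-integrable `[-1, 1] (EFin \o (fun x => h k x ^+ 2)) }.

Lemma symT_delta h m x : (m <= k)%N -> symT h (delta m) x = (1 - x) ^+ m * h m x.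
Proof.
rewrite -ltnS => mk; rewrite /symT (bigD1 (Ordinal mk))//= /delta eqxx mul1r.
rewrite big1 ?addr0// => j; rewrite -val_eqE/= => /negbTE ->.
by rewrite mul0r.
Qed.

Lemma symT_left h c : jet h -> c k = 0 -> symT h c (-1) = 0.
Proof.
move=> jh ck; rewrite /symT big_ord_recr/= ck mul0r addr0 big1// => j _.
by rewrite (jet_left jh) ?mulr0.
Qed.

Lemma eul_symT h c b : -1 <= b -> b < 1 -> jet h -> c k = 0 ->
  eul b (symT h c) (symT h (symA 0 c)).
Proof.
move=> mb b1 jh ck.
have pj (j : 'I_k) := pacZ (c j) (pacM mb (pac_onem (-1) b j)
  (pac_sub (lexx (-1)) mb (ltW b1) (jet_pac jh (ltn_ord j)))).
have := pac_sum pj; apply: eq_pac => x /andP[_ xb].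
  by rewrite /symT big_ord_recr/= ck mul0r addr0.
have y0 : 1 - x != 0 by rewrite gt_eqF// (onem_gt0 b1).
have -> : symT h (symA 0 c) x = (1 - x) *
    \sum_(i < k) c i * ((1 - x) ^+ i * h i.+1 x + h i x * - (i%:R * (1 - x) ^+ i.-1)).
  rewrite mulr_sumr /symT.
  transitivity (\sum_(i < k) c i * ((1 - x) ^+ i.+1 * h i.+1 x) -
                \sum_(i < k) (i%:R * c i) * ((1 - x) ^+ i * h i x)); last first.
    rewrite -sumrB; apply: eq_bigr => i _; rewrite !exprS.
    by case: (nat_of_ord i) => [|m]/=; rewrite ?exprS; ring.
  rewrite [X in _ = X - _](_ : _ = \sum_(i < k.+1)
      (if val i is i'.+1 then c i' else 0) * ((1 - x) ^+ i * h i x)); last first.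
    by rewrite big_ord_recl/= mul0r add0r.
  rewrite [X in _ = _ - X](_ : _ = \sum_(i < k.+1)
      (i%:R * c i) * ((1 - x) ^+ i * h i x)); last first.
    by rewrite big_ord_recr/= ck mulr0 mul0r addr0.
  rewrite -sumrB; apply: eq_bigr => i _.
  by rewrite /symA /=; case: (nat_of_ord i) => [|m]/=; ring.
by rewrite mulrA mulVf// mul1r.
Qed.

Definition Phi h i x := symT h (symB i (delta 0)) x.

Lemma Phi0 h x : Phi h 0 x = h 0%N x.
Proof. by rewrite /Phi symT_delta// expr0 mul1r. Qed.

Lemma PhiS h i x : Phi h i.+1 x =
  symT h (symA 0 (symB i (delta 0))) x + (k + i)%:R * Phi h i x.
Proof. by rewrite /Phi/= symT_A. Qed.

Lemma eul_Phi h i b : -1 <= b -> b < 1 -> jet h -> (i < k)%N ->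
  eul b (Phi h i) (symT h (symA 0 (symB i (delta 0)))).
Proof.
move=> mb b1 jh ik; apply: eul_symT => //.
by rewrite symB_delta_supp// add0n.
Qed.

Lemma Phi_left h i : jet h -> (i < k)%N -> Phi h i (-1) = 0.
Proof. by move=> jh ik; apply: symT_left => //; rewrite symB_delta_supp// add0n. Qed.

Lemma integrable_Phi h i b : -1 <= b -> b < 1 -> jet h -> (0 < k)%N -> (i <= k)%N ->
  mu.-integrable `[-1, b] (EFin \o Phi h i).
Proof.
move=> mb b1 jh k0; case: i => [_|i ik].
  by apply: integrable_itv_cont; exact: eul_continuous mb _ _ (eul_Phi mb b1 jh k0).
exact: (eul_step_integrable mb b1 (eul_Phi mb b1 jh ik) (PhiS h i)).
Qed.

Lemma Phi_le h i b : -1 <= b -> b < 1 -> jet h -> (i <= k)%N ->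
  (\prod_(j < i) (k + j).+1%:R) * \int[mu]_(x in `[-1, b]) `|h 0%N x|
  <= \int[mu]_(x in `[-1, b]) `|Phi h i x|.
Proof.
move=> mb b1 jh; elim: i => [_|i IH ik].
  rewrite big_ord0 mul1r le_eqVlt; apply/orP; left; apply/eqP.
  by apply: eq_Rintegral_itv => x _; rewrite Phi0.
have := eul_step mb b1 (eul_Phi mb b1 jh ik) (Phi_left jh ik) (PhiS h i).
apply: le_trans; rewrite big_ord_recr/= [X in X * _]mulrC -mulrA ler_wpM2l//.
exact: IH (ltnW ik).
Qed.

Definition Psi h i x := symT h (symB i (delta (k - i.+1))) x.

Definition boundary h i b : R :=
  \sum_(j < i) (2 * j + 1)%:R * ((1 - b)^-1 ^+ (2 * k).-1 * Psi h j b ^+ 2).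

Lemma boundary_ge0 h i b : b < 1 -> 0 <= boundary h i b.
Proof.
move=> b1; apply: sumr_ge0 => j _; apply: mulr_ge0 => //.
by apply: mulr_ge0; rewrite ?sqr_ge0// exprn_ge0// invr_ge0 subr_ge0 ltW.
Qed.

(* With Q_i the function in the statement and Psi_i as above,
   Q_i = (theta + k-1-i) Psi_i and Q_{i+1} = (theta + k+i) Psi_i, so that
   (Q_{i+1}^2 - Q_i^2) / (1-x)^(2k) = (2i+1) (Psi_i^2 / (1-x)^(2k-1))'. *)
Lemma symT_isometry h i b : -1 <= b -> b < 1 -> jet h -> (i <= k)%N ->
  mu.-integrable `[-1, b] (EFin \o (fun x =>
    (1 - x)^-1 ^+ (2 * k) * symT h (symB i (delta (k - i))) x ^+ 2)) /\
  \int[mu]_(x in `[-1, b])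
    ((1 - x)^-1 ^+ (2 * k) * symT h (symB i (delta (k - i))) x ^+ 2) =
  \int[mu]_(x in `[-1, b]) (h k x ^+ 2) + boundary h i b.
Proof.
move=> mb b1 jh; elim: i => [_|i IH ik].
  have E x : -1 <= x <= b -> h k x ^+ 2 =
      (1 - x)^-1 ^+ (2 * k) * symT h (symB 0 (delta (k - 0))) x ^+ 2.
    move=> /andP[_ xb]; rewrite subn0 /= symT_delta// exprMn -exprM mulnC mulrA.
    by rewrite [X in X * _]mulrC (onemVK b1)// mul1r.
  split.
    apply: eq_integrable_itv E _.
    exact: integrable_sub_itv (lexx _) (ltW b1) (jet_L2 jh).
  by rewrite /boundary big_ord0 addr0 -(eq_Rintegral_itv E).
have [iq qE] := IH (ltnW ik).
have kiE : (k - i = (k - i.+1).+1)%N by rewrite subnSK.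
have ck : symB i (delta (k - i.+1)) k = 0.
  by apply: symB_delta_supp; rewrite -addSn -kiE subnK// ltnW.
have ePsi := eul_symT mb b1 jh ck.
have pQ := pacZ (2 * i + 1)%:R (eul_quad mb b1 (2 * k).-1 ePsi).
have k0 : (0 < 2 * k)%N by rewrite muln_gt0/=; case: (k) ik.
have E x : -1 <= x <= b ->
   (2 * i + 1)%:R * ((1 - x)^-1 ^+ (2 * k).-1.+1 *
     ((2 * k).-1%:R * symT h (symB i (delta (k - i.+1))) x ^+ 2 +
      2 * (symT h (symB i (delta (k - i.+1))) x *
           symT h (symA 0 (symB i (delta (k - i.+1)))) x))) +
   (1 - x)^-1 ^+ (2 * k) * symT h (symB i (delta (k - i))) x ^+ 2 =
   (1 - x)^-1 ^+ (2 * k) * symT h (symB i.+1 (delta (k - i.+1))) x ^+ 2.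
  move=> _; rewrite prednK//.
  rewrite kiE -symA_delta symB_A /= !(symT_A _ _%:R).
  set P := symT h _ x; set P0 := symT h _ x.
  have -> : (2 * k).-1%:R = 2 * k%:R - 1 :> R.
    by rewrite -subn1 natrB// natrM.
  have -> : (k - i.+1)%:R = k%:R - i%:R - 1 :> R.
    by rewrite natrB// -natr1; ring.
  by rewrite (natrD _ (2 * i)%N 1%N) (natrD _ k i) natrM; ring.
have [iQ _] := pQ.
have iS := integrable_itvD iQ iq.
split; first exact: eq_integrable_itv E iS.
rewrite -(eq_Rintegral_itv E) RintegralD// qE (pacE mb pQ).
rewrite /boundary big_ord_recr/= (symT_left jh ck) expr0n/= !mulr0 subr0.
by rewrite /Psi; ring.
Qed.

End symbols.

(** * Jets of functions vanishing at the endpoints *)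

Section jets.
Context (R : realType) (k : nat).
Hypothesis k0 : (0 < k)%N.
Implicit Types (a x : R) (c : nat -> R) (h : nat -> R -> R).
Local Notation mu := (leb R).

Lemma ltN11 : (-1 : R) < 1.
Proof. by rewrite -subr_gt0 opprK. Qed.

Lemma amgm (s u w : R) : 0 < s -> 2 * (u * w) <= s * u ^+ 2 + w ^+ 2 / s.
Proof.
move=> s0; rewrite -subr_ge0.
have -> : s * u ^+ 2 + w ^+ 2 / s - 2 * (u * w) = s * (u - w / s) ^+ 2.
  by field; rewrite gt_eqF.
by rewrite mulr_ge0 ?sqr_ge0// ltW.
Qed.

Lemma jet_integrable h j : jet k h -> (j < k)%N -> mu.-integrable `[-1, 1] (EFin \o h j.+1).
Proof. by move=> jh jk; have [] := jet_pac jh jk. Qed.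

Lemma jet_tail h j x : jet k h -> (j < k)%N -> -1 <= x -> x <= 1 ->
  `|h j x| <= \int[mu]_(t in `[x, 1]) `|h j.+1 t|.
Proof.
move=> jh jk x1 x2.
have pj := pac_sub x1 x2 (lexx _) (jet_pac jh jk).
have := pacE x2 pj; rewrite (jet_right jh jk) sub0r => E.
rewrite -normrN -E; case: pj => ij _.
exact: le_normr_Rintegral.
Qed.

Lemma Rintegral_itv_cst (x y r : R) : x <= y ->
  \int[mu]_(t in `[x, y]) r = r * (y - x).
Proof.
move=> xy; have pc := pacZ r (pac_horner x y 'X).
have := pacE xy pc; rewrite !hornerE -mulrBr => <-.
by apply: eq_Rintegral_itv => t _; rewrite derivX hornerC mulr1.
Qed.

Lemma integrable_itv_cst (x y r : R) : mu.-integrable `[x, y] (EFin \o (fun=> r)).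
Proof.
have [+ _] := pacZ r (pac_horner x y 'X).
by apply: eq_integrable_itv => t _; rewrite derivX hornerC mulr1.
Qed.

Lemma jet_decay_top h e : jet k h -> 0 < e ->
  exists2 d, -1 <= d < 1 &
  forall x, d <= x <= 1 -> `|h k.-1 x| <= e * Num.sqrt (1 - x).
Proof.
move=> jh e0.
have pU := pac_prim (jet_L2 jh).
have [d d1 Hd] := pac_left_approx (ltW ltN11) ltN11 pU (exprn_gt0 2 e0).
exists d => // x dx; have /andP[dx1 xle1] := dx; have /andP[md dlt1] := d1.
have k1k : (k.-1 < k)%N by rewrite prednK.
have x1 := le_trans md dx1.
move: xle1; rewrite le_eqVlt => /predU1P[->|xlt1].
  by rewrite (jet_right jh)// normr0 subrr sqrtr0 mulr0.
have xle1 := ltW xlt1.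
set r := Num.sqrt (1 - x).
have r0 : 0 < r by rewrite sqrtr_gt0 subr_gt0.
have rr : 1 - x = r ^+ 2 by rewrite sqr_sqrtr// subr_ge0.
have := Hd x dx.
rewrite (Rintegral_itv_split x1 xle1 (jet_L2 jh)) addrAC subrr add0r => tail.
have {}tail := le_trans (ler_norm _) tail.
have := jet_tail jh k1k x1 xle1; rewrite prednK// => hx.
have iu : mu.-integrable `[x, 1] (EFin \o h k).
  by have := jet_integrable jh k1k; rewrite prednK//; exact: integrable_sub_itv.
have iu2 := integrable_sub_itv x1 (lexx _) (jet_L2 jh).
have s0 : 0 < r / e by rewrite divr_gt0.
have i1 := integrable_itvZ (r / e) iu2.
have i2 := integrable_itv_cst x 1 (e / r).
have : \int[mu]_(t in `[x, 1]) (2 * `|h k t|) <=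
       \int[mu]_(t in `[x, 1]) (r / e * h k t ^+ 2 + e / r).
  apply: le_Rintegral_itv.
  - exact/integrable_itvZ/integrable_itv_norm.
  - exact: integrable_itvD.
  - move=> t _; have := amgm `|h k t| 1 s0.
    by rewrite mulr1 expr1n div1r invf_div real_normK// num_real.
rewrite RintegralZl//; last exact: integrable_itv_norm.
rewrite RintegralD// RintegralZl// Rintegral_itv_cst// rr.
have -> : e / r * r ^+ 2 = e * r by field; rewrite gt_eqF.
have : r / e * \int[mu]_(t in `[x, 1]) h k t ^+ 2 <= r / e * e ^+ 2.
  by rewrite ler_pM2l.
have -> : r / e * e ^+ 2 = e * r by field; rewrite gt_eqF.
by lra.
Qed.

Lemma jet_decay h e : jet k h -> 0 < e ->
  exists2 d, -1 <= d < 1 & forall j x, (j < k)%N -> d <= x <= 1 ->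
  `|h j x| <= e * Num.sqrt (1 - x) * (1 - x) ^+ (k.-1 - j).
Proof.
move=> jh e0; have [d /andP[d1 d2] Hd] := jet_decay_top jh e0.
exists d; first by rewrite d1.
suff H m x : (m < k)%N -> d <= x <= 1 ->
    `|h (k.-1 - m)%N x| <= e * Num.sqrt (1 - x) * (1 - x) ^+ m.
  move=> j x jk dx.
  have jk1 : (j <= k.-1)%N by rewrite -ltnS prednK.
  have := H (k.-1 - j)%N x; rewrite subKn//; apply => //.
  by rewrite (leq_ltn_trans (leq_subr _ _))// prednK.
elim: m x => [|m IH] x mk dx; first by rewrite subn0 expr0 mulr1 Hd.
have mk1 : (m.+1 <= k.-1)%N by rewrite -ltnS prednK.
have jk : (k.-1 - m.+1 < k)%N by rewrite (leq_ltn_trans (leq_subr _ _))// prednK.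
have /andP[dx1 x1] := dx.
have mx : -1 <= x by exact: le_trans dx1.
apply: le_trans (jet_tail jh jk mx x1) _; rewrite subnSK//.
set r := e * Num.sqrt (1 - x) * (1 - x) ^+ m.
have -> : e * Num.sqrt (1 - x) * (1 - x) ^+ m.+1 = r * (1 - x).
  by rewrite /r exprSr mulrA.
rewrite -Rintegral_itv_cst//; apply: le_Rintegral_itv.
- apply: integrable_itv_norm; have := jet_integrable jh jk.
  by rewrite subnSK//; exact: integrable_sub_itv.
- exact: integrable_itv_cst.
- move=> t /andP[xt t1].
  have := IH t (ltnW mk); rewrite (le_trans dx1 xt) t1 => /(_ isT)/le_trans; apply.
  rewrite /r; apply: ler_pM.
  + by rewrite mulr_ge0 ?sqrtr_ge0// ltW.
  + by rewrite exprn_ge0// subr_ge0.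
  + by rewrite ler_pM2l// ler_wsqrtr//; lra.
  + by rewrite lerXn2r ?nnegrE ?subr_ge0//; lra.
Qed.

Lemma symT_decay h e d : 0 <= e ->
  (forall j x, (j < k)%N -> d <= x <= 1 ->
    `|h j x| <= e * Num.sqrt (1 - x) * (1 - x) ^+ (k.-1 - j)) ->
  forall c x, c k = 0 -> d <= x < 1 ->
  (1 - x)^-1 ^+ (2 * k).-1 * symT k h c x ^+ 2 <= (e * \sum_(j < k.+1) `|c j|) ^+ 2.
Proof.
move=> e0 Hd c x ck /andP[dx x1].
have y0 : 0 < 1 - x by rewrite subr_gt0.
have : `|symT k h c x| <= e * (\sum_(j < k.+1) `|c j|) * (Num.sqrt (1 - x) * (1 - x) ^+ k.-1).
  rewrite /symT [e * _]mulrC mulr_suml mulr_suml.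
  apply: le_trans (ler_norm_sum _ _ _) _; apply: ler_sum => j _.
  have [jk|kj] := ltnP j k; last first.
    have -> : (j : nat) = k by apply/eqP; rewrite eqn_leq kj -ltnS ltn_ord.
    by rewrite ck normr0 !mul0r normr0.
  rewrite normrM -mulrA ler_wpM2l//.
  rewrite normrM ger0_norm; last by rewrite exprn_ge0// ltW.
  have := Hd j x jk; rewrite dx (ltW x1) => /(_ isT) h1.
  apply: le_trans (ler_wpM2l (exprn_ge0 _ (ltW y0)) h1) _.
  have jk1 : (j <= k.-1)%N by rewrite -ltnS prednK.
  have -> : (1 - x) ^+ k.-1 = (1 - x) ^+ j * (1 - x) ^+ (k.-1 - j).
    by rewrite -exprD subnKC.
  by rewrite le_eqVlt; apply/orP; left; apply/eqP; ring.
move=> hT.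
have E : (1 - x)^-1 ^+ (2 * k).-1 * (Num.sqrt (1 - x) * (1 - x) ^+ k.-1) ^+ 2 = 1.
  rewrite exprMn sqr_sqrtr ?ltW// -exprM -exprS.
  have -> : ((k.-1 * 2).+1 = (2 * k).-1)%N by have := k0; lia.
  by rewrite -exprMn mulVf ?expr1n// gt_eqF.
rewrite -[leRHS]mulr1 -[X in _ <= _ * X]E [leRHS]mulrCA -[X in _ <= _ * X]exprMn.
rewrite ler_wpM2l//; first by rewrite exprn_ge0// invr_ge0 ltW.
rewrite -(real_normK (num_real (symT _ _ _ _))) ler_sqr ?nnegrE//.
exact: le_trans hT.
Qed.

Lemma boundary_cvg h e : jet k h -> 0 < e ->
  exists2 d, -1 <= d < 1 & forall b, d <= b < 1 -> boundary k h k b <= e.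
Proof.
move=> jh e0.
pose C (i : 'I_k) := \sum_(j < k.+1) `|symB k i (delta R (k - i.+1)) j|.
pose D := \sum_(i < k) (2 * i + 1)%:R * C i ^+ 2.
have D0 : 0 <= D by apply: sumr_ge0 => i _; rewrite mulr_ge0// sqr_ge0.
have D1 : 0 < D + 1 by rewrite ltr_wpDl.
pose s := Num.sqrt (e / (D + 1)).
have s0 : 0 < s by rewrite sqrtr_gt0 divr_gt0.
have [d d1 Hd] := jet_decay jh s0.
exists d => // b db.
apply: (@le_trans _ _ (s ^+ 2 * D)); last first.
  rewrite sqr_sqrtr; last by rewrite divr_ge0// ltW.
  by rewrite mulrAC ler_pdivrMr// ler_pM2l// lerDl.
rewrite /boundary /D mulr_sumr; apply: ler_sum => i _.
rewrite [leRHS]mulrCA ler_wpM2l//.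
rewrite -exprMn; apply: (symT_decay (ltW s0) Hd) => //.
apply: symB_delta_supp.
by have := ltn_ord i; lia.
Qed.

(* (2k)! / k! *)
Definition bigM : R := \prod_(j < k) (k + j).+1%:R.

(* The deficit in 2 |Phi_k| <= t (|Phi_k| / (1-x)^k)^2 + (1-x)^(2k) / t. *)
Definition defect h (t b : R) : R := \int[mu]_(x in `[-1, b])
  ((1 - x)^-1 ^+ k * `|Phi k h k x| - (1 - x) ^+ k / t) ^+ 2.

Section defect.
Variables (h : nat -> R -> R) (t b : R).
Hypotheses (jh : jet k h) (t0 : 0 < t) (mb : -1 <= b) (b1 : b < 1).

Let iPhi : mu.-integrable `[-1, b] (EFin \o Phi k h k).
Proof. exact: integrable_Phi. Qed.

Let PhiE : Phi k h k = symT k h (symB k k (delta R (k - k))).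
Proof. by rewrite subnn. Qed.

Let iy n : mu.-integrable `[-1, b] (EFin \o (fun x => (1 - x) ^+ n)).
Proof. by apply: integrable_itv_cont; exact: pac_continuous (pac_onem _ _ _). Qed.

Let defectE x : -1 <= x <= b ->
  ((1 - x)^-1 ^+ k * `|Phi k h k x| - (1 - x) ^+ k / t) ^+ 2 =
  (1 - x)^-1 ^+ (2 * k) * symT k h (symB k k (delta R (k - k))) x ^+ 2
  + t^-1 * (t^-1 * (1 - x) ^+ (2 * k) - 2 * `|Phi k h k x|).
Proof.
move=> /andP[_ xb]; rewrite -PhiE.
have E := onemVK b1 k xb.
rewrite -(real_normK (num_real (Phi k h k x))).
rewrite mulnC !exprM.
move: E; set y := (1 - x) ^+ k; set v := (1 - x)^-1 ^+ k; set p := `|_| => E.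
have -> : (v * p - y / t) ^+ 2 = v ^+ 2 * p ^+ 2 + t^-1 * (t^-1 * y ^+ 2 - 2 * ((y * v) * p)).
  by field; rewrite gt_eqF.
by rewrite E mul1r.
Qed.

Let i1 := (symT_isometry mb b1 jh (leqnn k)).1.
Let i2 := integrable_itvZ t^-1 (integrable_itvB (integrable_itvZ t^-1 (iy (2 * k)))
   (integrable_itvZ 2 (integrable_itv_norm iPhi))).

Lemma integrable_defect : mu.-integrable `[-1, b] (EFin \o (fun x =>
  ((1 - x)^-1 ^+ k * `|Phi k h k x| - (1 - x) ^+ k / t) ^+ 2)).
Proof.
by apply: eq_integrable_itv (integrable_itvD i1 i2) => x xb; rewrite defectE.
Qed.

Lemma defect_eq : t * defect h t b + 2 * \int[mu]_(x in `[-1, b]) `|Phi k h k x| =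
  t * (\int[mu]_(x in `[-1, b]) (h k x ^+ 2) + boundary k h k b) +
  (\int[mu]_(x in `[-1, b]) (1 - x) ^+ (2 * k)) / t.
Proof.
rewrite /defect (eq_Rintegral_itv defectE) RintegralD//.
rewrite (symT_isometry mb b1 jh (leqnn k)).2.
have iPn := integrable_itv_norm iPhi.
rewrite RintegralZl//; last first.
  by apply: integrable_itvB; [exact: integrable_itvZ|exact: (integrable_itvZ 2 iPn)].
rewrite RintegralB//; [|exact: integrable_itvZ|exact: (integrable_itvZ 2 iPn)].
rewrite RintegralZl// RintegralZl//.
by field; rewrite gt_eqF.
Qed.

End defect.
End jets.

Section inequality.
Context (R : realType) (k : nat).
Hypothesis k0 : (0 < k)%N.
Implicit Types (a x t : R) (c : nat -> R) (h : nat -> R -> R).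
Local Notation mu := (leb R).
Local Notation M := (bigM R k).

Definition bigK : R := \int[mu]_(x in `[-1, 1]) (1 - x) ^+ (2 * k).

Definition energy h : R := \int[mu]_(x in `[-1, 1]) (h k x ^+ 2).

Lemma bigM_gt0 : 0 < M.
Proof. by apply: prodr_gt0. Qed.

Lemma bigKE : bigK = 2 ^+ (2 * k).+1 / (2 * k).+1%:R.
Proof.
have := pacE (ltW (ltN11 R)) (pacZ (- (2 * k).+1%:R^-1) (pac_onem (-1) 1 (2 * k).+1)).
rewrite subrr expr0n/= mulr0 sub0r mulNr opprK opprK -[1 + 1]/(2) mulrC => <-.
apply: eq_Rintegral_itv => x _.
by rewrite mulrNN mulrA mulVf ?mul1r.
Qed.

Lemma bigK_gt0 : 0 < bigK.
Proof. by rewrite bigKE divr_gt0// exprn_gt0. Qed.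

Lemma pac_jet_norm h j : jet k h -> (j < k)%N ->
  pac (-1) 1 (fun x => \int[mu]_(t in `[-1, x]) `|h j t|) (fun x => `|h j x|).
Proof.
move=> jh jk; apply/pac_prim/integrable_itv_norm/integrable_itv_cont.
exact: pac_continuous (ltW (ltN11 R)) (jet_pac jh jk).
Qed.

Lemma le_Rintegral_sub_itv (x y z w : R) (f : R -> R) : z <= x -> y <= w ->
  (forall s, z <= s <= w -> 0 <= f s) -> mu.-integrable `[z, w] (EFin \o f) ->
  \int[mu]_(s in `[x, y]) f s <= \int[mu]_(s in `[z, w]) f s.
Proof.
move=> zx yw f0 jf; apply: le_Rintegral_subset => //.
  move=> s /=; rewrite !in_itv/= => /andP[xs sy].
  by rewrite (le_trans zx)//= (le_trans sy).
Qed.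

Lemma defect_le h t b : jet k h -> 0 < t -> -1 <= b < 1 ->
  2 * M * (\int[mu]_(x in `[-1, 1]) `|h 0%N x|) + t * defect k h t b
  <= t * energy h + bigK / t.
Proof.
move=> jh t0 /andP[mb b1].
have M0 := bigM_gt0; have M20 : 0 < 2 * M by rewrite mulr_gt0.
apply/ler_addgt0Pr => e e0.
have [|d /andP[md d1] Hd] := boundary_cvg k0 jh (_ : 0 < e / t).
  by rewrite divr_gt0.
set a0 := Num.max b d.
have a01 : a0 < 1 by rewrite gt_max b1.
have ma0 : -1 <= a0 by rewrite le_max mb.
pose H x := \int[mu]_(t in `[-1, x]) `|h 0%N t|.
have pH : pac a0 1 H (fun x => `|h 0%N x|).
  by apply: pac_sub (pac_jet_norm jh k0) => //; exact: ltW.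
suff : H 1 <= (t * energy h + bigK / t + e - t * defect k h t b) / (2 * M).
  by rewrite ler_pdivlMr// mulrC lerBrDr.
apply: (pac_le_end (ltW a01) a01 pH) => x /andP[].
rewrite ge_max => /andP[bx dx] x1.
have mx := le_trans mb bx.
rewrite ler_pdivlMr// mulrC lerBrDr -mulrA.
have := Phi_le mx x1 jh (leqnn k); rewrite -/(bigM R k) -/(H x) => hP.
have := defect_eq k0 jh t0 mx x1.
have hD : defect k h t b <= defect k h t x.
  apply: le_Rintegral_sub_itv => //; first by move=> s _; exact: sqr_ge0.
  exact: integrable_defect.
have hU : \int[mu]_(x in `[-1, x]) (h k x ^+ 2) <= energy h.
  apply: le_Rintegral_sub_itv => //; [exact: ltW|by move=> s _; exact: sqr_ge0|].
  exact: jet_L2.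
have hK : \int[mu]_(x in `[-1, x]) (1 - x) ^+ (2 * k) <= bigK.
  apply: le_Rintegral_sub_itv => //; first exact: ltW.
    by move=> s _; rewrite exprM exprn_ge0// sqr_ge0.
  apply: integrable_itv_cont.
  exact: pac_continuous (ltW (ltN11 R)) (pac_onem _ _ _).
have := Hd x; rewrite dx x1 => /(_ isT) hB.
have hK' : (\int[mu]_(x in `[-1, x]) (1 - x) ^+ (2 * k)) / t <= bigK / t.
  by rewrite ler_pM2r// invr_gt0.
have hD' : t * defect k h t b <= t * defect k h t x by rewrite ler_pM2l.
have hU' : t * (\int[mu]_(x in `[-1, x]) (h k x ^+ 2) + boundary k h k x) <= t * energy h + e.
  have -> : t * energy h + e = t * (energy h + e / t) by field; rewrite gt_eqF.
  by rewrite ler_pM2l//; exact: lerD.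
by lra.
Qed.

Lemma defect_ge0 h t b : 0 <= defect k h t b.
Proof. by apply: Rintegral_ge0 => s _; exact: sqr_ge0. Qed.

Lemma energy_ge0 h : 0 <= energy h.
Proof. by apply: Rintegral_ge0 => s _; exact: sqr_ge0. Qed.

Lemma jet_inequality h : jet k h ->
  M * (\int[mu]_(x in `[-1, 1]) `|h 0%N x|) <= Num.sqrt (bigK * energy h).
Proof.
move=> jh; set I := \int[mu]_(x in _) _.
have K0 := bigK_gt0; have M0 := bigM_gt0.
have hle t : 0 < t -> 2 * (M * I) <= t * energy h + bigK / t.
  move=> t0; have := @defect_le h t (-1) jh t0.
  rewrite lexx ltN11 => /(_ isT); rewrite -/I.
  have : 0 <= t * defect k h t (-1) by rewrite mulr_ge0 ?defect_ge0// ltW.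
  by lra.
have := energy_ge0 h; rewrite le_eqVlt => /predU1P[E0|E0].
  rewrite -E0 mulr0 sqrtr0; apply/ler_addgt0Pr => e e0; rewrite add0r.
  have := hle (bigK / e) (divr_gt0 K0 e0); rewrite -E0 mulr0 add0r.
  have -> : bigK / (bigK / e) = e by field; rewrite !gt_eqF.
  by lra.
have s0 : 0 < Num.sqrt (bigK * energy h) by rewrite sqrtr_gt0 mulr_gt0.
have := hle _ (divr_gt0 s0 E0).
rewrite divfK ?gt_eqF// invf_div.
have -> : bigK * (energy h / Num.sqrt (bigK * energy h)) = Num.sqrt (bigK * energy h).
  rewrite mulrA -{1}[bigK * energy h]sqr_sqrtr ?mulr_ge0// 1?ltW//.
  by rewrite expr2 mulfK// gt_eqF.
by lra.
Qed.

End inequality.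

Lemma continuous_itv_eq0 (R : realType) (a b : R) (f : R -> R) : a <= b ->
  {within `[a, b], continuous f} -> (forall x, a <= x <= b -> 0 <= f x) ->
  \int[leb R]_(x in `[a, b]) f x <= 0 -> forall x, a < x < b -> f x = 0.
Proof.
move=> ab cf f0 If x /andP[ax xb].
have jf := integrable_itv_cont cf.
have := @continuous_FTC1_closed R f a x b xb jf ax.
have fx : {for x, continuous f}.
  by have /(continuous_within_itvP _ (lt_trans ax xb))[+ _ _] := cf; apply; rewrite in_itv/= ax.
move=> /(_ fx)[_ <-].
have E0 y : a < y < b -> \int[leb R]_(t in `[a, y]) f t = 0.
  move=> /andP[ay yb]; apply/eqP; rewrite eq_le; apply/andP; split.
    apply: le_trans If; apply: le_Rintegral_sub_itv => //; exact: ltW.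
  apply: Rintegral_ge0 => t; rewrite /= in_itv/= => /andP[at_ ty].
  by apply: f0; rewrite at_ (le_trans ty)// ltW.
have := derive_cst (0 : R) x (1 : R); rewrite derive1E => <-.
apply: near_eq_derive => //.
have : \forall y \near x, y \in `]a, b[ by apply: near_in_itvoo; rewrite in_itv/= ax.
by apply: filterS => y; rewrite in_itv/= => /E0.
Qed.

Section equality.
Context (R : realType) (k : nat).
Hypothesis k0 : (0 < k)%N.
Implicit Types (a x t : R) (c : nat -> R) (h : nat -> R -> R).
Local Notation mu := (leb R).
Local Notation M := (bigM R k).

Lemma Phi_inj0 h : jet k h -> (forall x, -1 < x < 1 -> Phi k h k.-1 x = 0) ->
  forall x, -1 < x < 1 -> h 0%N x = 0.
Proof.
move=> jh P0 x /andP[x1 x2].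
have k1k : (k.-1 < k)%N by rewrite prednK.
pose b := (x + 1) / 2.
have xb : x < b by rewrite /b; lra.
have b1 : b < 1 by rewrite /b; lra.
have mb : -1 <= b by rewrite /b; lra.
have cn : {within `[-1, b], continuous (fun x => `|h 0%N x|)}.
  have := pac_continuous mb (pac_sub (lexx _) mb (ltW b1) (jet_pac jh k0)).
  by move=> ch z; apply: cvg_norm; exact: ch.
apply: normr0_eq0.
apply: (continuous_itv_eq0 mb cn); rewrite ?x1//.
have I0 : \int[mu]_(y in `[-1, b]) `|Phi k h k.-1 y| = 0.
  rewrite (eq_Rintegral_itv (g := fun=> 0)); last first.
    move=> y /andP[]; rewrite le_eqVlt => /predU1P[<- _|y1 yb].
      by rewrite Phi_left// normr0.
    by rewrite P0 ?normr0// y1 (le_lt_trans yb).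
  by rewrite Rintegral_itv_cst// mul0r.
have := Phi_le mb b1 jh (ltnW k1k); rewrite I0 pmulr_rle0//.
by apply: prodr_gt0.
Qed.

Lemma weighted_bound h t b : jet k h -> 0 < t -> -1 <= b -> b < 1 ->
  defect k h t b <= 0 ->
  \int[mu]_(x in `[-1, b]) ((1 - x)^-1 ^+ (2 * k) * `|Phi k h k x|) <= (b + 1) / t.
Proof.
move=> jh t0 mb b1 D0.
have iPhi := integrable_itv_norm (integrable_Phi mb b1 jh k0 (leqnn k)).
have iD := integrable_defect k0 jh t0 mb b1.
have iV n := integrable_itv_cont (@continuous_onemV _ b mb b1 n).
set V := \int[mu]_(x in `[-1, b]) ((1 - x)^-1 ^+ (2 * k)).
have V0 : 0 <= V.
  apply: Rintegral_ge0 => x; rewrite /= in_itv/= => /andP[_ xb].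
  by rewrite exprn_ge0// invr_ge0 ltW// (onem_gt0 b1).
apply/ler_addgt0Pr => e e0.
pose s := (V + 1) / (2 * e).
have V1 : 0 < V + 1 by rewrite ltr_wpDl.
have s0 : 0 < s by rewrite divr_gt0// mulr_gt0.
pose d x := ((1 - x)^-1 ^+ k * `|Phi k h k x| - (1 - x) ^+ k / t) ^+ 2.
have is1 : mu.-integrable `[-1, b] (EFin \o (fun x => s * d x)) by exact: integrable_itvZ.
have is2 := integrable_itvZ s^-1 (iV (2 * k)%N).
have is3 := integrable_itvZ 2^-1 (integrable_itvD is1 is2).
have ic := integrable_itv_cst (-1) b t^-1.
apply: (@le_trans _ _ (\int[mu]_(x in `[-1, b])
    (t^-1 + 2^-1 * (s * d x + s^-1 * (1 - x)^-1 ^+ (2 * k))))).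
  apply: le_Rintegral_itv.
  - exact: integrable_bounded_mul (@continuous_onemV _ b mb b1 (2 * k)%N) iPhi.
  - exact: integrable_itvD.
  - move=> x /andP[_ xb]; rewrite /d.
    have E := onemVK b1 k xb.
    rewrite mulnC !exprM.
    move: E; set y := (1 - x) ^+ k; set v := (1 - x)^-1 ^+ k; set p := `|_| => E.
    have := amgm (v * p - y / t) v s0.
    have -> : (v * p - y / t) * v = v ^+ 2 * p - (y * v) / t.
      by field; rewrite gt_eqF.
    by rewrite E mul1r [v ^+ 2 / s]mulrC; lra.
rewrite RintegralD// Rintegral_itv_cst// RintegralZl//; last exact: integrable_itvD.
rewrite RintegralD// RintegralZl// RintegralZl// -/V.
have : s * (\int[mu]_(x in `[-1, b]) d x) <= 0 by rewrite pmulr_rle0.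
have : s^-1 * V <= 2 * e.
  by rewrite /s invf_div mulrAC ler_pdivrMr// ler_pM2l ?mulr_gt0// lerDl.
rewrite opprK mulrC; lra.
Qed.

Lemma jet_equality h : jet k h -> 0 < energy k h ->
  M * (\int[mu]_(x in `[-1, 1]) `|h 0%N x|) = Num.sqrt (bigK R k * energy k h) ->
  exists s, forall x, -1 < x < 1 ->
    Phi k h k.-1 x = s * ((1 - x) ^+ (2 * k).-1 * (1 + x)).
Proof.
move=> jh U0; set I := \int[mu]_(x in _) _ => eqI.
have K0 := bigK_gt0 R k; have M0 := bigM_gt0 R k.
set S := Num.sqrt _ in eqI.
have SS : S ^+ 2 = bigK R k * energy k h by rewrite sqr_sqrtr// mulr_ge0// ltW.
have S0 : 0 < S by rewrite sqrtr_gt0 mulr_gt0.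
pose t := S / energy k h.
have t0 : 0 < t by rewrite divr_gt0.
have tU : t * energy k h = S by rewrite divfK// gt_eqF.
have Kt : bigK R k / t = S.
  rewrite /t invf_div mulrA -SS expr2 mulfK// gt_eqF//.
have D0 b : -1 <= b < 1 -> defect k h t b <= 0.
  move=> hb; have := defect_le k0 jh t0 hb.
  rewrite -/I tU Kt -mulrA eqI -(pmulr_rle0 _ t0); lra.
have k1k : (k.-1 < k)%N by rewrite prednK.
pose N x := t^-1 * ((1 - x) ^+ (2 * k).-1 * (1 + x)).
have kk : (k + k.-1)%N = (2 * k).-1 by have := k0; lia.
have PhiN x : -1 <= x < 1 -> `|Phi k h k.-1 x| <= N x.
  move=> /andP[mx x1].
  have := eul_step_le mx x1 (eul_Phi mx x1 jh k1k) (Phi_left jh k1k) (PhiS k h k.-1).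
  move=> /(_ x); rewrite mx lexx => /(_ isT); rewrite prednK// kk.
  have -> : (2 * k).-1.+1 = (2 * k)%N by have := k0; lia.
  move=> /le_trans; apply; rewrite /N mulrCA ler_wpM2l//.
    by rewrite exprn_ge0// subr_ge0 ltW.
  rewrite mulrC addrC; apply: weighted_bound => //.
  by apply: D0; rewrite mx.
have pz : pac (-1) 1 (fun x => 1 + x) (fun=> 1).
  have := pac_horner (-1) 1 ('X + 1%:P : {poly R}).
  by apply: eq_pac => x _; rewrite ?derivD ?derivX ?derivC !hornerE// addrC.
have N11 := ltW (ltN11 R).
have pN := pacZ t^-1 (pacM N11 (pac_onem (-1) 1 (2 * k).-1) pz).
have cN : {within `[-1, 1], continuous N} := pac_continuous N11 pN.
have iN := integrable_itv_cont cN.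
have IN : S = (2 * k)%:R * \int[mu]_(x in `[-1, 1]) N x.
  have := pacE N11 (pacZ t^-1 (pacM N11 (pac_onem (-1) 1 (2 * k)) pz)).
  rewrite !subrr expr0n muln_eq0/= (gtn_eqF k0)/= !(mulr0, mul0r) subrr.
  rewrite (eq_Rintegral_itv (g := fun x => t^-1 * (1 - x) ^+ (2 * k) - (2 * k)%:R * N x)); last first.
    by move=> x _; rewrite /N; ring.
  have iK : mu.-integrable `[-1, 1] (EFin \o (fun x : R => (1 - x) ^+ (2 * k))).
    by apply: integrable_itv_cont; exact: pac_continuous N11 (pac_onem _ _ _).
  rewrite RintegralB//; [|exact: integrable_itvZ|exact: integrable_itvZ].
  rewrite RintegralZl// RintegralZl// -/(bigK R k) mulrC Kt.
  by move/eqP; rewrite subr_eq0 => /eqP.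
pose M' : R := \prod_(j < k.-1) (k + j).+1%:R.
have ME : M = (2 * k)%:R * M'.
  have MR (F : nat -> R) : \prod_(j < k) F j = F k.-1 * \prod_(j < k.-1) F j.
    by case: (k) k0 => // n _; rewrite big_ord_recr mulrC.
  by rewrite /bigM (MR (fun j => (k + j).+1%:R)) kk prednK// muln_gt0.
have k20 : 0 < (2 * k)%:R :> R by rewrite ltr0n muln_gt0.
have IE : M' * I = \int[mu]_(x in `[-1, 1]) N x.
  apply: (mulfI (lt0r_neq0 k20)); rewrite -IN -eqI ME; ring.
have PhiE x : -1 < x < 1 -> `|Phi k h k.-1 x| = N x.
  move=> /andP[x1 x2].
  pose b := (x + 1) / 2.
  have xb : x < b by rewrite /b; lra.
  have b1 : b < 1 by rewrite /b; lra.
  have mb : -1 <= b by rewrite /b; lra.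
  have cP y : -1 <= y -> y < 1 -> {within `[-1, y], continuous (fun x => N x - `|Phi k h k.-1 x|)}.
    move=> my y1; have cPhi := eul_continuous my (eul_Phi my y1 jh k1k).
    have cN' := pac_continuous my (pac_sub (lexx _) my (ltW y1) pN).
    by move=> z; apply: cvgB; [exact: cN'|apply: cvg_norm; exact: cPhi].
  suff : N x - `|Phi k h k.-1 x| = 0 by lra.
  apply: (continuous_itv_eq0 mb (cP b mb b1)); rewrite ?x1//.
    by move=> y /andP[my yb]; rewrite subr_ge0 PhiN// my (le_lt_trans yb).
  have pH := pacB (pacZ M' (pac_jet_norm jh k0)) (pac_prim iN).
  set D := \int[mu]_(x in _) _.
  have : M' * I - \int[mu]_(x in `[-1, 1]) N x <= - D.
    apply: (pac_le_end (ltW b1) b1 (pac_sub mb (ltW b1) (lexx 1) pH)) => y /andP[bY y1].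
    have my := le_trans mb bY.
    have iP := integrable_itv_norm (integrable_Phi my y1 jh k0 (ltnW k1k)).
    have iNy := integrable_sub_itv (lexx _) (ltW y1) iN.
    have := Phi_le my y1 jh (ltnW k1k); rewrite -/M' => hP.
    have : D <= \int[mu]_(x in `[-1, y]) (N x - `|Phi k h k.-1 x|).
      apply: le_Rintegral_sub_itv => //; last exact: integrable_itvB.
      by move=> z /andP[mz zy]; rewrite subr_ge0 PhiN// mz (le_lt_trans zy).
    by rewrite RintegralB//; lra.
  by rewrite IE subrr oppr_ge0.
have N0 x : -1 < x < 1 -> 0 < N x.
  move=> /andP[x1 x2]; rewrite /N !mulr_gt0 ?invr_gt0//.
    by rewrite exprn_gt0// subr_gt0.
  by lra.
have sgn x y : -1 < x -> x <= y -> y < 1 -> 0 < Phi k h k.-1 x * Phi k h k.-1 y.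
  move=> x1 xy y1; have my : -1 <= y by lra.
  have cP : {within `[x, y], continuous (Phi k h k.-1)}.
    apply: continuous_subspaceW (eul_continuous my (eul_Phi my y1 jh k1k)) => z /=.
    by rewrite !in_itv/= => /andP[xz ->]; rewrite (le_trans (ltW x1)).
  rewrite ltNge; apply/negP => P0.
  have [|c] := @IVT _ (Phi k h k.-1) x y 0 xy cP.
    rewrite ge_min le_max; have [Px|Px] := leP (Phi k h k.-1 x) 0.
      have [//|Py] := leP 0 (Phi k h k.-1 y); first by rewrite orbT.
      have := PhiE x; rewrite x1 (le_lt_trans xy)// => /(_ isT) Ex.
      have : 0 < N x by apply: N0; rewrite x1 (le_lt_trans xy).
      have : Phi k h k.-1 x < 0.
        rewrite lt_neqAle Px andbT -normr_eq0 Ex gt_eqF//.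
        by apply: N0; rewrite x1 (le_lt_trans xy).
      by move=> Px0; move: P0; rewrite leNgt nmulr_rgt0// Py.
    by rewrite (ltW Px) orTb andbT; move: P0; rewrite pmulr_rle0// => ->; rewrite orbT.
  rewrite in_itv/= => /andP[xc cy] Pc.
  have cc : -1 < c < 1 by rewrite (lt_le_trans x1)//= (le_lt_trans cy).
  by have := N0 c cc; rewrite -PhiE// Pc normr0 ltxx.
have sgn0 x : -1 < x < 1 -> 0 < Phi k h k.-1 0 * Phi k h k.-1 x.
  move=> /andP[x1 x2]; have [x0|x0] := leP x 0.
    by rewrite mulrC; apply: sgn => //; lra.
  by apply: sgn => //; lra.
exists (Num.sg (Phi k h k.-1 0) * t^-1) => x xx.
rewrite -mulrA -/(N x) -PhiE//.
have := sgn0 x xx.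
have [P0|P0|->] := ltgtP (Phi k h k.-1 0) 0; last by rewrite mul0r ltxx.
  by rewrite nmulr_rgt0// => Px; rewrite ltr0_sg// ltr0_norm// mulN1r opprK.
by rewrite pmulr_rgt0// => Px; rewrite gtr0_sg// gtr0_norm// mul1r.
Qed.
End equality.

(** * The Landau kernel *)

Section landau_poly.
Context (R : realType) (k : nat).
Local Notation mu := (leb R).

Definition lpoly : {poly R} := (1 - 'X) ^+ k * (1 + 'X) ^+ k.

Definition ljet (j : nat) : R -> R := horner lpoly^`(j).

Lemma lpolyE x : lpoly.[x] = (1 - x ^+ 2) ^+ k.
Proof. by rewrite /lpoly !hornerE -exprMn; congr (_ ^+ _); ring. Qed.

Lemma derivn_exp_root (p q : {poly R}) (x : R) j : (j < k)%N -> p.[x] = 0 ->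
  (p ^+ k * q)^`(j).[x] = 0.
Proof.
move=> jk px.
suff [r ->] : exists r, (p ^+ k * q)^`(j) = p ^+ (k - j) * r.
  by rewrite hornerM horner_exp px expr0n subn_eq0 leqNgt jk mul0r.
elim: j jk => [_|j IH jk]; first by exists q; rewrite subn0.
have [r E] := IH (ltnW jk).
rewrite derivnS E derivM deriv_exp -mulr_natl -(subnSK (ltnW jk)) succnK.
by exists ((k - j.+1).+1%:R * p^`() * r + p * r^`()); rewrite exprS; ring.
Qed.

Lemma ljet_left j : (j < k)%N -> ljet j (-1) = 0.
Proof.
move=> jk; rewrite /ljet /lpoly mulrC derivn_exp_root//.
by rewrite !hornerE subrr.
Qed.

Lemma ljet_right j : (j < k)%N -> ljet j 1 = 0.
Proof. by move=> jk; rewrite /ljet /lpoly derivn_exp_root// !hornerE subrr. Qed.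

Lemma jet_ljet : jet k ljet.
Proof.
split; [|exact: ljet_left|exact: ljet_right|].
- by move=> j _; rewrite /ljet derivnS; exact: pac_horner.
- have [+ _] := pac_horner (-1) 1 (lpoly^`(k) ^+ 2).
  have := pac_continuous (ltW (ltN11 R)) (pac_horner (-1) 1 (lpoly^`(k) ^+ 2)).
  move=> /integrable_itv_cont + _; apply: eq_integrable_itv => x _.
  by rewrite horner_exp.
Qed.

Definition symP (c : nat -> R) : {poly R} :=
  \sum_(j < k.+1) c j *: ((1 - 'X) ^+ j * lpoly^`(j)).

Lemma horner_symP c x : (symP c).[x] = symT k ljet c x.
Proof.
rewrite /symP horner_sum; apply: eq_bigr => j _.
by rewrite hornerZ hornerM horner_exp !hornerE.
Qed.

Lemma deriv_symP c : c k = 0 -> (1 - 'X) * (symP c)^`() = symP (symA 0 c).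
Proof.
move=> ck; rewrite /symP big_ord_recr/= ck scale0r addr0 (big_morph _ (@derivD R) (@deriv0 R)) mulr_sumr.
transitivity (\sum_(i < k) c i *: ((1 - 'X) ^+ i.+1 * lpoly^`(i.+1)) -
              \sum_(i < k) (i%:R * c i) *: ((1 - 'X) ^+ i * lpoly^`(i))).
  rewrite -sumrB; apply: eq_bigr => i _.
  rewrite derivZ derivM -derivnS deriv_exp derivB derivX derivC sub0r.
  rewrite -mulr_natl -!mul_polyC polyCM polyC_natr.
  by case: (nat_of_ord i) => [|m] /=; rewrite ?exprS; ring.
rewrite [X in X - _](_ : _ = \sum_(i < k.+1)
    (if val i is i'.+1 then c i' else 0) *: ((1 - 'X) ^+ i * lpoly^`(i))); last first.
  by rewrite big_ord_recl/= scale0r add0r.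
rewrite [X in _ - X](_ : _ = \sum_(i < k.+1)
    (i%:R * c i) *: ((1 - 'X) ^+ i * lpoly^`(i))); last first.
  by rewrite big_ord_recr/= ck mulr0 scale0r addr0.
rewrite -sumrB; apply: eq_bigr => i _.
rewrite -scalerBl; congr (_ *: _).
by rewrite /symA /=; case: (nat_of_ord i) => [|m]/=; ring.
Qed.

Definition Phi_poly (i : nat) : {poly R} := (1 - 'X) ^+ (k + i) * (1 + 'X) ^+ (k - i).

Lemma deriv_onemX_onepX (a b : nat) :
  (1 - 'X) * ((1 - 'X) ^+ a * (1 + 'X) ^+ b.+1)^`()
    + a%:R * ((1 - 'X) ^+ a * (1 + 'X) ^+ b.+1) =
  b.+1%:R * ((1 - 'X) ^+ a.+1 * (1 + 'X) ^+ b) :> {poly R}.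
Proof.
have du : (1 - 'X : {poly R})^`() = -1 by rewrite derivB derivX derivC sub0r.
have dw : (1 + 'X : {poly R})^`() = 1 by rewrite derivD derivX derivC add0r.
rewrite derivM !deriv_exp du dw succnK -(mulr_natl (-1 * _) a) -(mulr_natl (1 * _) b.+1).
move: (1 - 'X : {poly R}) (1 + 'X : {poly R}) => u w.
move: (b.+1%:R : {poly R}) => r.
case: a => [|a]; first by rewrite !exprS; ring.
by rewrite succnK; move: (a.+1%:R : {poly R}) => q; rewrite !exprS; ring.
Qed.

Lemma deriv_Phi_poly i : (i < k)%N ->
  (1 - 'X) * (Phi_poly i)^`() + (k + i)%:R * Phi_poly i = (k - i)%:R * Phi_poly i.+1.
Proof.
by move=> ik; rewrite /Phi_poly addnS -(subnSK ik) deriv_onemX_onepX.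
Qed.

Lemma symP_ffact i : (i <= k)%N ->
  symP (symB k i (delta R 0)) = (k ^_ i)%:R * Phi_poly i.
Proof.
elim: i => [_|i IH ik].
  rewrite /symP big_ord_recl/= /delta eqxx scale1r expr0 mul1r big1 => [|j _].
    by rewrite addr0 /Phi_poly addn0 subn0 mul1r.
  by rewrite scale0r.
have ck : symB k i (delta R 0) k = 0 by rewrite symB_delta_supp// add0n.
have -> : symP (symB k i.+1 (delta R 0)) =
    symP (symA 0 (symB k i (delta R 0))) + (k + i)%:R *: symP (symB k i (delta R 0)).
  rewrite /symP scaler_sumr -big_split/=; apply: eq_bigr => j _.
  rewrite scalerA -scalerDl; congr (_ *: _).
  by rewrite /symA; case: (nat_of_ord j) => [|m]; ring.
rewrite -deriv_symP// (IH (ltnW ik)).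
have -> : ((k ^_ i)%:R * Phi_poly i)^`() = (k ^_ i)%:R * (Phi_poly i)^`().
  by rewrite !mulr_natl derivMn.
have -> (p : {poly R}) : (k + i)%:R *: p = (k + i)%:R * p by rewrite scaler_nat mulr_natl.
rewrite ffactnSr natrM -mulrA -(deriv_Phi_poly ik).
move: (Phi_poly i) => p; move: (p^`()) (1 - 'X : {poly R}) => p' y.
move: ((k ^_ i)%:R : {poly R}) ((k + i)%:R : {poly R}) => r s.
by ring.
Qed.

Lemma Phi_ljet i x : (i <= k)%N ->
  Phi k ljet i x = (k ^_ i)%:R * ((1 - x) ^+ (k + i) * (1 + x) ^+ (k - i)).
Proof.
move=> ik; rewrite /Phi -horner_symP symP_ffact//.
by rewrite -polyC_natr hornerM hornerC hornerM !horner_exp !hornerE.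
Qed.

Lemma int_Phi_poly i : (i < k)%N ->
  (k + i).+1%:R * \int[mu]_(x in `[-1, 1]) (Phi_poly i).[x] =
  (k - i)%:R * \int[mu]_(x in `[-1, 1]) (Phi_poly i.+1).[x].
Proof.
move=> ik.
have N11 := ltW (ltN11 R).
have ip (p : {poly R}) : mu.-integrable `[-1, 1] (EFin \o horner p).
  exact: integrable_itv_cont (pac_continuous N11 (pac_horner (-1) 1 p)).
have := pacE N11 (pac_horner (-1) 1 ((1 - 'X) * Phi_poly i)).
have -> : ((1 - 'X) * Phi_poly i).[1] = 0.
  by rewrite hornerM (_ : (1 - 'X).[1] = 0) ?mul0r// !hornerE subrr.
have -> : ((1 - 'X) * Phi_poly i).[-1] = 0.
  have z1 : (1 + 'X : {poly R}).[-1] = 0 by rewrite !hornerE subrr.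
  by rewrite /Phi_poly !hornerM !horner_exp z1 expr0n subn_eq0 leqNgt ik !mulr0.
have -> : ((1 - 'X) * Phi_poly i)^`() =
    (k - i)%:R%:P * Phi_poly i.+1 - (k + i).+1%:R%:P * Phi_poly i.
  rewrite derivM derivB derivX derivC !polyC_natr -deriv_Phi_poly//.
  by rewrite -natr1; ring.
rewrite (eq_Rintegral_itv (g := fun x => (k - i)%:R * (Phi_poly i.+1).[x] - (k + i).+1%:R * (Phi_poly i).[x])); last first.
  by move=> x _; rewrite hornerD hornerN !hornerM !hornerC.
rewrite RintegralB//; [|exact: (integrable_itvZ _ (ip _))|exact: (integrable_itvZ _ (ip _))].
rewrite RintegralZl; [|by []|exact: ip].
rewrite RintegralZl; [|by []|exact: ip].
by rewrite subrr => /eqP; rewrite subr_eq0 => /eqP.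
Qed.

Lemma bigM_lpoly : bigM R k * \int[mu]_(x in `[-1, 1]) lpoly.[x] = k`!%:R * bigK R k.
Proof.
have H i : (i <= k)%N -> (\prod_(j < i) (k + j).+1%:R) * \int[mu]_(x in `[-1, 1]) lpoly.[x]
    = (k ^_ i)%:R * \int[mu]_(x in `[-1, 1]) (Phi_poly i).[x].
  elim: i => [_|i IH ik].
    by rewrite big_ord0 /Phi_poly addn0 subn0.
  rewrite big_ord_recr -mulrA (mulrC _ (\int[mu]_(x in _) _)) mulrA (IH (ltnW ik)).
  rewrite -mulrA (mulrC (\int[mu]_(x in _) _)) (int_Phi_poly ik) mulrA.
  by rewrite ffactnSr natrM.
rewrite /bigM H// ffactnn; congr (_ * _).
apply: eq_Rintegral_itv => x _.
by rewrite /Phi_poly subnn expr0 mulr1 horner_exp !hornerE addnn mul2n.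
Qed.

Hypothesis k0 : (0 < k)%N.

Lemma energy_ljet : energy k ljet <= k`!%:R ^+ 2 * bigK R k.
Proof.
have N11 := ltW (ltN11 R).
have pU := pac_prim (jet_L2 jet_ljet).
apply: (pac_le_end N11 (ltN11 R) pU) => b /andP[mb b1].
have [_] := symT_isometry mb b1 jet_ljet (leqnn k).
rewrite subnn => E.
have iK c d : mu.-integrable `[c, d] (EFin \o (fun x : R => (1 - x) ^+ (2 * k))).
  have := pac_horner c d ((1 - 'X) ^+ (2 * k)).
  have [cd|dc] := leP c d; last first.
    by move=> _; rewrite set_itv_ge ?bnd_simp -?ltNge//; exact: integrable_set0.
  move=> /(pac_continuous cd)/integrable_itv_cont; apply: eq_integrable_itv => x _.
  by rewrite horner_exp !hornerE.
have {}E : k`!%:R ^+ 2 * \int[mu]_(x in `[-1, b]) (1 - x) ^+ (2 * k) =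
    \int[mu]_(x in `[-1, b]) (ljet k x ^+ 2) + boundary k ljet k b.
  rewrite -E -RintegralZl//; apply: eq_Rintegral_itv => x /andP[_ xb].
  rewrite -/(Phi k ljet k x) Phi_ljet// subnn expr0 mulr1 ffactnn addnn -mul2n.
  rewrite exprMn mulrCA; congr (_ * _).
  by rewrite expr2 mulrCA mulrA -mulrA [X in _ * X]mulrC (onemVK b1)// mulr1.
have B0 := boundary_ge0 k ljet k b1.
have : \int[mu]_(x in `[-1, b]) (1 - x) ^+ (2 * k) <= bigK R k.
  apply: le_Rintegral_sub_itv => //; first exact: ltW.
  by move=> s _; rewrite exprM exprn_ge0// sqr_ge0.
have F0 : 0 < k`!%:R ^+ 2 :> R by rewrite exprn_gt0// ltr0n fact_gt0.
by rewrite -(ler_pM2l F0); lra.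
Qed.

End landau_poly.

(** * The Sobolev space *)

Section sobolev.
Context (R : realType).
Implicit Types (f F g : R -> R) (x y : R) (p : {poly R}).
Local Notation mu := (leb R).

Lemma abs_continuous_near F e : abs_continuous F -> 0 < e ->
  exists2 d, 0 < d & forall x y, x <= y -> y - x < d -> `|F y - F x| < e.
Proof.
move=> acF e0; have [d d0 Hd] := acF e e0; exists d => // x y xy yxd.
have := Hd 1%N (fun=> x) (fun=> y); rewrite !big_ord1; apply => //.
by apply/trivIsetP => i j _ _; rewrite (ord1 i) (ord1 j) eqxx.
Qed.

Lemma abs_continuous_continuous F : abs_continuous F -> continuous F.
Proof.
move=> acF x; apply/cvgrPdist_lt => e e0.
have [d d0 Hd] := abs_continuous_near acF e0.
apply/nbhs_ballP; exists d => // y; rewrite /ball/= ltr_norml => /andP[xyd yxd].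
have [xy|yx] := leP x y; first by rewrite distrC; apply: Hd => //; lra.
by apply: Hd; [exact: ltW|lra].
Qed.

Lemma derive1n_horner_open f p (U : set R) : open U ->
  (forall x, U x -> f x = p.[x]) ->
  forall n x, U x -> derive1n n f x = p^`(n).[x].
Proof.
move=> oU fp; elim=> [|n IH] x Ux; first exact: fp.
rewrite derive1nS derive1E derivnS.
have [_ <-] := is_derive_poly p^`(n) x.
apply: near_eq_derive; near=> y; apply: IH; near: y.
exact: open_nbhs_nbhs.
Unshelve. all: by end_near. Qed.

Lemma derive1n_zero_open f (U : set R) : open U ->
  (forall x, U x -> f x = 0) -> forall n x, U x -> derive1n n f x = 0.
Proof.
move=> oU f0 n x Ux.
have := @derive1n_horner_open f 0 U oU _ n x Ux.
by rewrite linear0 horner0; apply => y /f0 ->; rewrite horner0.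
Qed.

Variable k : nat.
Hypothesis k0 : (0 < k)%N.

Lemma W0_out f x : W0 k f -> ~~ (-1 <= x <= 1) -> f x = 0.
Proof.
move=> Wf xout; apply/eqP; apply: contraNT xout => fx.
have : closure [set x | f x != 0] x by exact: subset_closure.
by move=> /(W0_support Wf); rewrite /= in_itv.
Qed.

Lemma W0_derive_out f j x : W0 k f -> ~~ (-1 <= x <= 1) -> derive1n j f x = 0.
Proof.
move=> Wf; rewrite negb_and -!ltNge => /orP[x1|x1].
  apply: (@derive1n_zero_open f [set y | y < -1] (@open_lt R (-1))) => // y y1.
  by apply: (W0_out Wf); rewrite negb_and -ltNge y1.
apply: (@derive1n_zero_open f [set y | y > 1] (@open_gt R 1)) => // y y1.
by apply: (W0_out Wf); rewrite negb_and -!ltNge y1 orbT.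
Qed.

Lemma W0_derive_left f j : W0 k f -> (j < k)%N -> derive1n j f (-1) = 0.
Proof.
move=> Wf jk; apply/eqP; rewrite -normr_le0; apply/ler_addgt0Pr => e e0.
have [d d0 Hd] := abs_continuous_near (W0_abs_continuous Wf jk) e0.
have : `|derive1n j f (-1) - derive1n j f (-1 - d / 2)| < e by apply: Hd; lra.
rewrite (@W0_derive_out f j (-1 - d / 2) Wf) ?subr0 ?add0r; first exact: ltW.
by rewrite negb_and -ltNge; apply/orP; left; lra.
Qed.

Lemma W0_derive_right f j : W0 k f -> (j < k)%N -> derive1n j f 1 = 0.
Proof.
move=> Wf jk; apply/eqP; rewrite -normr_le0; apply/ler_addgt0Pr => e e0.
have [d d0 Hd] := abs_continuous_near (W0_abs_continuous Wf jk) e0.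
have : `|derive1n j f (1 + d / 2) - derive1n j f 1| < e by apply: Hd; lra.
rewrite (@W0_derive_out f j (1 + d / 2) Wf) ?sub0r ?normrN ?add0r; first exact: ltW.
by rewrite negb_and -!ltNge; apply/orP; right; lra.
Qed.

Lemma jet_W0 f : W0 k f -> jet k (fun j => derive1n j f).
Proof.
move=> Wf.
have N11 := ltW (ltN11 R).
have L2 : mu.-integrable `[-1, 1] (EFin \o (fun x => derive1n k f x ^+ 2)).
  by have := Lfun2_integrable_sqr (W0_L2 Wf); apply: integrableS.
have mk : measurable_fun setT (derive1n k f).
  by have := W0_L2 Wf; rewrite inE => /andP[]; rewrite inE.
split=> [j jk|j jk|j jk|//]; last 2 first.
- exact: W0_derive_left.
- exact: W0_derive_right.
apply: pac_intro.
- exact: abs_continuous_null_variation (W0_abs_continuous Wf jk).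
- have [jk1|kj] := ltnP j.+1 k.
    apply: integrable_itv_cont; apply: continuous_subspaceT.
    exact: abs_continuous_continuous (W0_abs_continuous Wf jk1).
  have -> : j.+1 = k by lia.
  have := integrable_itvD (integrable_itv_cst (-1) 1 1) L2.
  move=> /integrable_itv_le; apply => [|x _]; first exact: measurable_funTS.
  set u := derive1n k f x.
  have := amgm `|u| 1 ltr01; rewrite mul1r divr1 mulr1 real_normK ?num_real//.
  have := normr_ge0 u; have := sqr_ge0 u; rewrite expr1n; lra.
- have der x : derivable (derive1n j f) x 1 -> is_derive x 1 (derive1n j f) (derive1n j.+1 f x).
    by move=> /derivableP; rewrite derive1nS derive1E.
  have [jk1|kj] := ltnP j.+1 k.
    by apply: aeW => x _; apply: der; exact: (W0_derivable Wf).
  have := W0_ae_derivable Wf; have -> : k.-1 = j by lia.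
  apply: (@filterS _ _ (ae_filter_ringOfSetsType mu)) => x dx _.
  exact: der.
Qed.

End sobolev.

Section landau.
Context (R : realType) (k : nat).
Hypothesis k0 : (0 < k)%N.
Implicit Types (x y : R).
Local Notation mu := (leb R).

Lemma is_derive0_intro (H : R -> R) x :
  (forall e, 0 < e -> exists2 d, 0 < d &
    forall y, `|y - x| < d -> `|H y - H x| <= e * `|y - x|) ->
  is_derive x 1 H 0.
Proof.
move=> HH.
have cH : h^-1 *: (H (h *: 1 + x) - H x) @[h --> 0^'] --> (0 : R).
  apply/cvgrPdist_le => e e0; have [d d0 Hd] := HH e e0.
  rewrite near_withinE; apply/nbhs_ballP; exists d => // h.
  rewrite /ball/= sub0r normrN => hd h0.
  rewrite sub0r normrN normrZ normfV mulrC ler_pdivrMr ?normr_gt0//.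
  have := Hd (h *: 1 + x); rewrite addrK [_ *: _]mulr1; exact.
by apply: DeriveDef; [apply/cvg_ex; exists 0|apply/cvg_lim => //; exact: Rhausdorff].
Qed.

Lemma lipschitz_abs_continuous (F : R -> R) (M : R) :
  (forall x y, x <= y -> `|F y - F x| <= M * (y - x)) -> abs_continuous F.
Proof.
move=> FM e e0; have N0 : 0 < `|M| + 1 by rewrite ltr_wpDl.
exists (e / (`|M| + 1)); first by rewrite divr_gt0.
move=> n a b ab _; rewrite ltr_pdivlMr// mulrC mulr_sumr; apply: le_lt_trans.
apply: ler_sum => i _; apply: le_trans (FM _ _ (ab i)) _.
by rewrite ler_wpM2r ?subr_ge0// (le_trans (ler_norm _))// lerDl.
Qed.

Definition cut j x : R := if -1 <= x <= 1 then @ljet R k j x else 0.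

Lemma landau_cut : @landau R k = cut 0.
Proof. by apply/funext => x; rewrite /landau /cut /ljet derivn0 lpolyE. Qed.

Lemma cut_out j x : ~~ (-1 <= x <= 1) -> cut j x = 0.
Proof. by rewrite /cut => /negbTE ->. Qed.

Lemma cut_derive_in j x : -1 < x < 1 -> is_derive x 1 (cut j) (cut j.+1 x).
Proof.
move=> /andP[x1 x2]; rewrite /cut !ltW//= /ljet derivnS.
apply: near_eq_is_derive (is_derive_poly _ x).
have : \forall y \near x, y \in `]-1, 1[ by apply: near_in_itvoo; rewrite in_itv/= x1.
by apply: filterS => y; rewrite in_itv/= => /andP[y1 y2]; rewrite !ltW.
Qed.

Lemma cut_derive_out j x : ~~ (-1 <= x <= 1) -> is_derive x 1 (cut j) (cut j.+1 x).
Proof.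
move=> xout; rewrite (cut_out _ xout).
apply: near_eq_is_derive (is_derive_cst (0 : R) x 1).
move: xout; rewrite negb_and -!ltNge => /orP[x1|x1].
  have : \forall y \near x, y < -1 by apply: open_nbhs_nbhs; split => //; exact: open_lt.
  by apply: filterS => y y1; rewrite cut_out// negb_and -ltNge y1.
have : \forall y \near x, y > 1 by apply: open_nbhs_nbhs; split => //; exact: open_gt.
by apply: filterS => y y1; rewrite cut_out// negb_and -!ltNge y1 orbT.
Qed.

Lemma cut_end j x : (j < k)%N -> `|x| = 1 -> cut j x = 0.
Proof.
move=> jk; have [x0|x0] := leP 0 x.
  by rewrite ger0_norm// => ->; rewrite /cut ljet_right// if_same.
by rewrite ltr0_norm// => /eqP; rewrite eqr_oppLR => /eqP ->; rewrite /cut ljet_left// if_same.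
Qed.

Lemma cut_derive_end j x : (j.+1 < k)%N -> `|x| = 1 ->
  is_derive x 1 (cut j) (cut j.+1 x).
Proof.
move=> jk x1; rewrite (cut_end jk x1).
have l0 : @ljet R k j x = 0 /\ @ljet R k j.+1 x = 0.
  have [x0|x0] := leP 0 x.
    have -> : x = 1 by rewrite -x1 ger0_norm.
    by rewrite !ljet_right// ltnW.
  have -> : x = -1 by rewrite -x1 ltr0_norm// opprK.
  by rewrite !ljet_left// ltnW.
have : is_derive x 1 (@ljet R k j) 0.
  by rewrite -l0.2 /ljet derivnS; exact: is_derive_poly.
move=> dl; apply: is_derive0_intro => e e0.
have [d d0 Hd] := is_derive0_approx dl e0; exists d => // y yxd.
rewrite (cut_end (ltnW jk) x1) subr0.
have := Hd y yxd; rewrite l0.1 subr0; apply: le_trans.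
by rewrite /cut; case: ifP => // _; rewrite normr0.
Qed.

Lemma abs_le1 x : `|x| != 1 -> -1 < x < 1 \/ ~~ (-1 <= x <= 1).
Proof.
move=> x1; have [xin|xout] := boolP (-1 <= x <= 1); [left|by right].
have : `|x| < 1 by rewrite lt_neqAle x1 ler_norml.
by rewrite ltr_norml.
Qed.

Lemma cut_derive j x : (j.+1 < k)%N || (`|x| != 1) ->
  is_derive x 1 (cut j) (cut j.+1 x).
Proof.
have [x1|x1 _] := eqVneq `|x| 1.
  by rewrite orbF => jk; exact: cut_derive_end.
by have [] := abs_le1 x1; [exact: cut_derive_in|exact: cut_derive_out].
Qed.

Lemma derive1n_landau j : (j < k)%N -> derive1n j (@landau R k) = cut j.
Proof.
elim: j => [|j IH] jk; first exact: landau_cut.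
apply/funext => x; rewrite derive1nS (IH (ltnW jk)) derive1E.
have jx : (j.+1 < k)%N || (`|x| != 1) by rewrite jk.
by have [_ ->] := cut_derive jx.
Qed.

Lemma derive1n_landau_top x : `|x| != 1 -> derive1n k (@landau R k) x = cut k x.
Proof.
move=> x1; have k1k : (k.-1 < k)%N by rewrite prednK.
have jx : (k.-1.+1 < k)%N || (`|x| != 1) by rewrite x1 orbT.
have := @derive1nS R R (@landau R k) k.-1; rewrite (derive1n_landau k1k) (prednK k0) => ->.
by rewrite derive1E; have [_ ->] := cut_derive jx; rewrite prednK.
Qed.

Lemma cut_abs_continuous j : (j < k)%N -> abs_continuous (cut j).
Proof.
move=> jk.
have N11 := ltW (ltN11 R).
have pj : pac (-1) 1 (@ljet R k j) (@ljet R k j.+1) := jet_pac (@jet_ljet R k) jk.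
have [M HM] : exists M, forall x, -1 <= x <= 1 -> `|@ljet R k j.+1 x| <= M.
  apply: continuous_itv_bounded.
  exact: (pac_continuous N11 (pac_horner (-1) 1 (lpoly R k)^`(j.+1))).
have M0 : 0 <= M by apply: le_trans (HM 1 _); rewrite ?N11 ?lexx.
have lip x y : -1 <= x -> x <= y -> y <= 1 -> `|@ljet R k j y - @ljet R k j x| <= M * (y - x).
  move=> x1 xy y1; have pxy := pac_sub x1 xy y1 pj.
  have [ixy _] := pxy; rewrite -(pacE xy pxy) -Rintegral_itv_cst//.
  apply: le_trans (le_normr_Rintegral _ ixy) _ => //.
  apply: le_Rintegral_itv; [exact: integrable_itv_norm|exact: integrable_itv_cst|].
  by move=> z /andP[xz zy]; rewrite HM// (le_trans x1)//= (le_trans zy).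
pose cl x := Num.max (-1) (Num.min x 1).
have clE x : cut j x = @ljet R k j (cl x).
  rewrite /cut /cl; have [x1|x1] := leP (-1) x; have [x2|x2] := leP x 1 => /=.
  - by rewrite (elimT max_idPr).
  - by rewrite (elimT max_idPr)// ljet_right.
  - by rewrite (elimT max_idPl) ?ljet_left// ltW.
  - by have := lt_trans x1 (lt_trans (ltN11 R) x2); rewrite ltxx.
apply: (@lipschitz_abs_continuous _ M) => x y xy; rewrite !clE.
have cl1 z : -1 <= cl z by rewrite /cl le_max lexx.
have cl2 z : cl z <= 1 by rewrite /cl ge_max N11/= ge_min lexx orbT.
have clm : cl x <= cl y.
  rewrite /cl ge_max !le_max lexx/=; apply/orP; right.
  by rewrite le_min !ge_min xy lexx orbT.
apply: le_trans (lip _ _ (cl1 x) clm (cl2 y)) _.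
rewrite ler_wpM2l//; rewrite /cl.
have [a1|a1] := leP x 1; have [b1|b1] := leP y 1;
  rewrite /Num.max; repeat case: ifP => ?; lra.
Qed.

Lemma landau_L2 : derive1n k (@landau R k) \in Lfun mu 2%:E.
Proof.
set u := derive1n k _.
have N11 := ltW (ltN11 R).
have uE : u = (fun x => ((@ljet R k k) \_ `]-1, 1[) x +
    (u 1 * \1_([set 1] : set R) x + u (-1) * \1_([set -1] : set R) x)).
  apply/funext => x; rewrite !indicE patchE.
  have [->|x1] := eqVneq x 1.
    rewrite memNset/= ?in_itv/= ?ltxx ?andbF// mem_set//.
    rewrite memNset/=; last by move=> /eqP; rewrite gt_eqF// ltN11.
    by rewrite mulr1 mulr0 addr0 add0r.
  have [->|xm1] := eqVneq x (-1).
    rewrite memNset/= ?in_itv/= ?ltxx// memNset/=; last by move=> /eqP; rewrite lt_eqF// ltN11.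
    by rewrite mem_set// mulr1 mulr0 !add0r.
  rewrite (@memNset _ [set 1]); last by move=> /= /eqP; rewrite (negbTE x1).
  rewrite (@memNset _ [set -1]); last by move=> /= /eqP; rewrite (negbTE xm1).
  rewrite !mulr0 !addr0.
  have xn : `|x| != 1 by rewrite eqr_norml ler01 andbT negb_or x1.
  rewrite /u (derive1n_landau_top xn).
  have [xin|xout] := abs_le1 xn.
    by rewrite mem_set/= ?in_itv//= /cut; case/andP: xin => /ltW -> /ltW ->.
  rewrite cut_out// memNset//= in_itv/= => /andP[/ltW h1 /ltW h2].
  by rewrite h1 h2 in xout.
have mu_u : measurable_fun setT u.
  rewrite uE; apply: measurable_funD.
    apply/(measurable_restrictT _ _).1 => //.
    apply: measurable_funS (continuous_itv_measurable
      (pac_continuous N11 (pac_horner (-1) 1 (lpoly R k)^`(k)))) => //.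
    exact: subset_itv_oo_cc.
  by apply: measurable_funD; apply: measurable_funM => //; exact: measurable_indic.
have [M HM] : exists M, forall x, -1 <= x <= 1 -> `|@ljet R k k x| <= M.
  apply: continuous_itv_bounded.
  exact: (pac_continuous N11 (pac_horner (-1) 1 (lpoly R k)^`(k))).
pose N := `|M| + `|u 1| + `|u (-1)|.
have uN x : -1 <= x <= 1 -> `|u x| <= N.
  move=> xx; have [->|x1] := eqVneq x 1; first by rewrite /N addrAC lerDr addr_ge0.
  have [->|xm1] := eqVneq x (-1); first by rewrite /N lerDr addr_ge0.
  have xn : `|x| != 1 by rewrite eqr_norml ler01 andbT negb_or x1.
  rewrite /u (derive1n_landau_top xn) /cut xx (le_trans (HM x xx))// (le_trans (ler_norm _))//.
  by rewrite /N -addrA lerDl addr_ge0.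
have u2 : mu.-integrable `[-1, 1] (EFin \o (fun x => u x ^+ 2)).
  apply: (integrable_itv_le _ (integrable_itv_cst (-1) 1 (N ^+ 2))).
    by apply: measurable_funX; exact: measurable_funTS.
  move=> x /uN ux; rewrite normrX ler_sqr ?nnegrE//.
  exact: le_trans ux.
have u0 x : ~~ (-1 <= x <= 1) -> u x = 0.
  move=> xout; have xn : `|x| != 1.
    by apply: contraNneq xout => x1; rewrite -ler_norml x1.
  by rewrite /u (derive1n_landau_top xn) cut_out.
have u2T : mu.-integrable setT (EFin \o (fun x => u x ^+ 2)).
  have -> : (fun x => u x ^+ 2) = (fun x => u x ^+ 2) \_ `[-1, 1].
    apply/funext => x; rewrite patchE; case: ifPn => // xn.
    rewrite u0 ?expr0n//; apply: contraNN xn => xx.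
    by rewrite inE/= in_itv.
  by rewrite -restrict_EFin; apply/integrable_restrict => //=; rewrite setTI.
rewrite inE; apply/andP; split; rewrite inE//=.
rewrite /finite_norm unlock; apply: poweR_lty.
have := integrable_lty _ u2T; move=> /(_ measurableT).
congr (_ < _)%E; apply: eq_integral => x _ /=.
by rewrite powR_mulrn// real_normK// num_real.
Qed.

Lemma W0_landau : W0 k (@landau R k).
Proof.
split.
- have /closure_id -> : closed (`[-1, 1]%classic : set R) by exact: interval_closed.
  apply: closure_subset => x /=; rewrite in_itv/=; apply: contraNT => xout.
  by rewrite /landau (negbTE xout).
- move=> j jk x; rewrite (derive1n_landau (ltnW jk)).
  have jx : (j.+1 < k)%N || (`|x| != 1) by rewrite jk.
  by have [] := cut_derive jx.
- by move=> j jk; rewrite (derive1n_landau jk); exact: cut_abs_continuous.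
- have k1k : (k.-1 < k)%N by rewrite prednK.
  rewrite (derive1n_landau k1k).
  have : (mu).-negligible ([set 1] `|` [set -1]).
    apply: negligibleU; apply/negligibleP => //; exact: lebesgue_measure_set1.
  apply: negligibleS => x /= nd; apply: contrapT => /not_orP[/eqP x1 /eqP xm1].
  have jx : (k.-1.+1 < k)%N || (`|x| != 1).
    by rewrite eqr_norml ler01 andbT negb_or x1 xm1 orbT.
  by apply: nd; have [] := cut_derive jx.
- exact: landau_L2.
Qed.

End landau.

Section main.
Context (R : realType) (k : nat).
Hypothesis k0 : (0 < k)%N.
Local Notation mu := (leb R).

Lemma Rintegral_itv_oo (a b : R) (f : R -> R) : mu.-integrable `[a, b] (EFin \o f) ->
  \int[mu]_(x in `[a, b]) f x = \int[mu]_(x in `]a, b[) f x.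
Proof.
move=> jf; rewrite -Rintegral_itv_obnd_cbnd; last first.
  apply: integrableS jf => // z /=; rewrite !in_itv/= => /andP[/ltW-> ->] //.
rewrite -Rintegral_itv_bndo_bndc//.
by apply: integrableS jf => // z /=; rewrite !in_itv/= => /andP[/ltW-> /ltW->].
Qed.

Lemma prod_odd_dfact n : (\prod_(j < n) (n + j).+1 = 2 ^ n * odd_dfact n)%N.
Proof.
elim: n => [|n IH]; first by rewrite /odd_dfact !big_ord0.
apply/eqP; rewrite -(eqn_pmul2l (ltn0Sn n)); apply/eqP.
have -> : (n.+1 * \prod_(j < n.+1) (n.+1 + j).+1 =
    (\prod_(j < n) (n + j).+1) * (n + n).+1 * (n + n).+2)%N.
  rewrite big_ord_recr/= mulnA; congr (_ * _)%N.
  transitivity (\prod_(j < n.+1) (n + j).+1)%N; last by rewrite big_ord_recr.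
  rewrite big_ord_recl/= addn0; congr (_ * _)%N.
  by apply: eq_bigr => j _; rewrite /bump/= addSn addnA addn1.
rewrite IH /odd_dfact big_ord_recr/= expnS; move: (\prod_(i < n) _)%N (2 ^ n)%N => x y.
by nia.
Qed.

Lemma sharp_constE : sharp_const R k = Num.sqrt (bigK R k) / bigM R k.
Proof.
have M2 : bigM R k = 2 ^+ k * (odd_dfact k)%:R.
  rewrite -natrX -natrM -prod_odd_dfact /bigM.
  by rewrite natr_prod.
have h0 : 0 < k%:R + 2^-1 :> R by rewrite ltr_wpDl// invr_gt0.
have -> : bigK R k = (2 ^+ k) ^+ 2 * (k%:R + 2^-1)^-1.
  have -> : k%:R + 2^-1 = (k%:R * 2 + 1) / 2 :> R by field.
  have h : k%:R * 2 + 1 != 0 :> R by rewrite gt_eqF// ltr_wpDl// mulr_ge0.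
  rewrite bigKE exprS mulnC exprM -(natr1 (k * 2)) natrM.
  by field.
rewrite sqrtrM ?sqr_ge0// sqrtr_sqr ger0_norm ?exprn_ge0// sqrtrV ?ltW// M2 /sharp_const.
have o0 : (odd_dfact k)%:R != 0 :> R.
  rewrite pnatr_eq0 -lt0n /odd_dfact prodn_gt0// => i; by rewrite addn1.
have e0 : 2 ^+ k != 0 :> R by rewrite expf_neq0.
have s0 : Num.sqrt (k%:R + 2^-1) != 0 :> R by rewrite gt_eqF// sqrtr_gt0.
by field; rewrite o0 e0 s0.
Qed.

Lemma norm2E (f : R -> R) :
  norm2 (derive1n k f) = Num.sqrt (energy k (fun j => derive1n j f)).
Proof.
rewrite /norm2 /energy; congr Num.sqrt; apply: eq_Rintegral_itv => x _.
by rewrite real_normK// num_real.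
Qed.

Lemma norm1_le_sharp f : W0 k f ->
  norm1 f <= sharp_const R k * norm2 (derive1n k f).
Proof.
move=> Wf; rewrite norm2E sharp_constE mulrAC ler_pdivlMr ?bigM_gt0// mulrC.
rewrite -sqrtrM; last exact/ltW/bigK_gt0.
exact: (jet_inequality k0 (jet_W0 k0 Wf)).
Qed.

Lemma sharp_eqE f : norm1 f = sharp_const R k * norm2 (derive1n k f) <->
  bigM R k * norm1 f = Num.sqrt (bigK R k * energy k (fun j => derive1n j f)).
Proof.
have M0 := bigM_gt0 R k.
rewrite norm2E sharp_constE sqrtrM; last exact/ltW/bigK_gt0.
rewrite mulrAC; split=> [->|<-]; first by rewrite mulrC divfK// gt_eqF.
by rewrite mulrAC mulfV ?mul1r// gt_eqF.
Qed.

Lemma energy_ljetE : Num.sqrt (bigK R k * energy k (@ljet R k)) = k`!%:R * bigK R k.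
Proof.
have K0 := bigK_gt0 R k.
have F0 : 0 < k`!%:R :> R by rewrite ltr0n fact_gt0.
apply/eqP; rewrite eq_le; apply/andP; split.
  rewrite -[leRHS]ger0_norm; last by rewrite mulr_ge0// ltW.
  rewrite -sqrtr_sqr ler_wsqrtr// exprMn mulrC expr2 mulrA ler_pM2r//.
  exact: energy_ljet.
have := jet_inequality k0 (@jet_ljet R k); apply: le_trans.
rewrite -bigM_lpoly ler_pM2l ?bigM_gt0//.
have ip : mu.-integrable `[-1, 1] (EFin \o horner (lpoly R k)).
  exact: integrable_itv_cont (pac_continuous (ltW (ltN11 R)) (pac_horner (-1) 1 _)).
apply: le_Rintegral_itv => //; first exact: integrable_itv_norm.
by move=> x _; rewrite /ljet derivn0 ler_norm.
Qed.

Lemma landauE x : -1 <= x <= 1 -> landau k x = (lpoly R k).[x].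
Proof. by move=> xx; rewrite /landau xx lpolyE. Qed.

Lemma norm1_landau f c : (forall x, f x = c * landau k x) ->
  norm1 f = `|c| * \int[mu]_(x in `[-1, 1]) (lpoly R k).[x].
Proof.
move=> fE.
have ip : mu.-integrable `[-1, 1] (EFin \o horner (lpoly R k)).
  exact: integrable_itv_cont (pac_continuous (ltW (ltN11 R)) (pac_horner (-1) 1 _)).
rewrite -RintegralZl//; apply: eq_Rintegral_itv => x xx.
rewrite fE landauE// normrM (ger0_norm (_ : 0 <= (lpoly R k).[x]))//.
rewrite lpolyE exprn_ge0// subr_ge0 -real_normK ?num_real//.
by rewrite expr_le1// ler_norml.
Qed.

Lemma landau_sharp_eq f c : W0 k f -> (forall x, f x = c * landau k x) ->
  norm1 f = sharp_const R k * norm2 (derive1n k f).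
Proof.
move=> Wf fE; apply/sharp_eqE.
have K0 := bigK_gt0 R k.
have N11 := ltW (ltN11 R).
rewrite (norm1_landau fE).
have -> : energy k (fun j => derive1n j f) = c ^+ 2 * energy k (@ljet R k).
  have i1 := jet_L2 (jet_W0 k0 Wf).
  have i2 := jet_L2 (@jet_ljet R k).
  rewrite /energy -RintegralZl// (Rintegral_itv_oo i1).
  rewrite (Rintegral_itv_oo (integrable_itvZ (c ^+ 2) i2)).
  apply: eq_Rintegral => x; rewrite inE => xx.
  rewrite (@derive1n_horner_open R f (c *: lpoly R k) `]-1, 1[%classic)//.
  - by rewrite derivnZ hornerZ exprMn.
  - move=> y; rewrite /= in_itv/= => /andP[y1 y2].
    by rewrite fE hornerZ landauE// !ltW.
rewrite [X in Num.sqrt X]mulrCA sqrtrM ?sqr_ge0// sqrtr_sqr energy_ljetE mulrCA bigM_lpoly.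
by [].
Qed.

Lemma sharp_eq_landau f : W0 k f ->
  norm1 f = sharp_const R k * norm2 (derive1n k f) ->
  exists c, forall x, f x = c * landau k x.
Proof.
move=> Wf /sharp_eqE; have jf := jet_W0 k0 Wf.
have M0 := bigM_gt0 R k; have N11 := ltW (ltN11 R).
have fin c : (forall x, -1 < x < 1 -> f x = c * landau k x) ->
    exists c, forall x, f x = c * landau k x.
  move=> fE; exists c => x.
  have [->|x1] := eqVneq x 1.
    by rewrite landau_cut cut_end// ?normr1// mulr0; exact: W0_derive_right Wf k0.
  have [->|xm1] := eqVneq x (-1).
    by rewrite landau_cut cut_end// ?normrN1// mulr0; exact: W0_derive_left Wf k0.
  have xn : `|x| != 1 by rewrite eqr_norml ler01 andbT negb_or x1.
  have [xin|xout] := abs_le1 xn; first exact: fE.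
  by rewrite (W0_out Wf)// landau_cut cut_out// mulr0.
have := energy_ge0 k (fun j => derive1n j f); rewrite le_eqVlt => /predU1P[U0|U0].
  rewrite -U0 mulr0 sqrtr0 => /eqP; rewrite mulf_eq0 gt_eqF//= => /eqP I0.
  apply: (fin 0) => x xx; rewrite mul0r; apply: normr0_eq0.
  have cf : {within `[-1, 1], continuous f} := pac_continuous N11 (jet_pac jf k0).
  have cn : {within `[-1, 1], continuous (fun x => `|f x|)}.
    by move=> z; apply: cvg_norm; exact: cf.
  by apply: (continuous_itv_eq0 N11 cn _ _ xx) => //; rewrite -[leLHS]/(norm1 f) I0.
move=> eqf; have [s Hs] := jet_equality k0 jf U0 eqf.
pose c := s / k`!%:R.
have F0 : k`!%:R != 0 :> R by rewrite pnatr_eq0 -lt0n fact_gt0.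
pose d j x := derive1n j f x - c * @ljet R k j x.
have jl := @jet_ljet R k.
have jd : jet k d.
  split.
  - by move=> j jk; have := pacB (jet_pac jf jk) (pacZ c (jet_pac jl jk)); exact.
  - by move=> j jk; rewrite /d (jet_left jf)// (jet_left jl)// mulr0 subrr.
  - by move=> j jk; rewrite /d (jet_right jf)// (jet_right jl)// mulr0 subrr.
  - have i1 := integrable_itvZ 2 (jet_L2 jf).
    have i2 := integrable_itvZ (2 * c ^+ 2) (jet_L2 jl).
    have k1k : (k.-1 < k)%N by rewrite prednK.
    have mf : measurable_fun `[-1 : R, 1] (derive1n k f).
      by have := integrable_itv_measurable (jet_integrable jf k1k); rewrite prednK.
    have ml : measurable_fun `[-1 : R, 1] (@ljet R k k).
      by have := integrable_itv_measurable (jet_integrable jl k1k); rewrite prednK.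
    apply: (integrable_itv_le _ (integrable_itvD i1 i2)).
      apply: measurable_funX; apply: measurable_funB => //.
      by apply: measurable_funM.
    move=> x _; rewrite /d ger0_norm ?sqr_ge0//.
    set u := derive1n k f x; set w := ljet k k x.
    rewrite -subr_ge0.
    have -> : 2 * u ^+ 2 + 2 * c ^+ 2 * w ^+ 2 - (u - c * w) ^+ 2 = (u + c * w) ^+ 2 by ring.
    exact: sqr_ge0.
have Phid i x : Phi k d i x = Phi k (fun j => derive1n j f) i x - c * Phi k (@ljet R k) i x.
  rewrite /Phi /symT mulr_sumr -sumrB; apply: eq_bigr => j _.
  by rewrite /d; ring.
apply: (fin c) => x xx.
have d0 : d 0%N x = 0.
  apply: (Phi_inj0 k0 jd _ xx) => y yy.
  rewrite Phid Hs// Phi_ljet ?leq_pred//.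
  have k1 : (k - k.-1 = 1)%N by lia.
  have -> : (k + k.-1 = (2 * k).-1)%N by lia.
  have -> : (k ^_ k.-1 = k`!)%N.
    have := ffactnSr k k.-1; rewrite prednK// ffactnn => ->.
    by rewrite k1 muln1.
  by rewrite k1 expr1 /c [X in _ - X]mulrA divfK// subrr.
rewrite landauE; last by case/andP: xx => x1 x2; rewrite !ltW.
by move/eqP: d0; rewrite /d subr_eq0 => /eqP.
Qed.

End main.

Unset Implicit Arguments.
Set Strict Implicit.

Theorem theorem1 (R : realType) (k : nat) (hk : (1 <= k)%N) :
  [/\ (forall f : R -> R, W0 k f ->
         norm1 f <= sharp_const R k * norm2 f^`(k)%classic),
      (forall C : R,
         (forall f : R -> R, W0 k f -> norm1 f <= C * norm2 f^`(k)%classic) ->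
         sharp_const R k <= C),
      W0 k (@landau R k) &
      (forall f : R -> R, W0 k f ->
         (norm1 f = sharp_const R k * norm2 f^`(k)%classic <->
          exists c : R, forall x : R, f x = c * landau k x))].
Proof.
have WL := W0_landau R hk.
split=> //.
- by move=> f; exact: norm1_le_sharp.
- move=> C HC.
  have E : norm1 (@landau R k) = sharp_const R k * norm2 (derive1n k (@landau R k)).
    by apply: (landau_sharp_eq hk WL (c := 1)) => x; rewrite mul1r.
  have := HC _ WL; rewrite E ler_pM2r// lt_neqAle sqrtr_ge0 andbT.
  apply: contraTneq (bigK_gt0 R k) => N0; rewrite -leNgt.
  have /norm1_landau : forall x, @landau R k x = 1 * landau k x by move=> x; rewrite mul1r.
  rewrite E -N0 mulr0 normr1 mul1r => I0.
  have := bigM_lpoly R k; rewrite -I0 mulr0 => /esym/eqP.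
  by rewrite mulf_eq0 pnatr_eq0 gtn_eqF ?fact_gt0//= => /eqP ->.
- move=> f Wf; split; first exact: sharp_eq_landau.
  by move=> [c fE]; exact: landau_sharp_eq fE.
Qed.
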